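(* Let $\mathfrak g=gl(m|n)$, let $\chi\in\mathfrak g_{\bar 0}^*$ with $\chi(\mathfrak N_0^+)=0$, let $M$ be a simple $u(\mathfrak g_{\bar 0},\chi)$-module, let $v\in M$ be a maximal vector of weight $\lambda$, and let $f_1(\lambda)\in\mathbf F$ be the scalar defined by $$e_1\cdots e_l\, f_1\cdots f_l\, v=f_1(\lambda)v\quad\text{in } Z^{\chi}(M).$$ (1) If $f_1(\lambda)\ne 0$, then $Z^{\chi}(M)$ is simple. (2) If $Z^{\chi}(M)$ is simple, then $f_1(\lambda)\neq 0$.
   Context: $\mathbf F$ is an algebraically closed field of characteristic $p>3$, $(m,n)\neq(1,1)$, and $\mathfrak g=gl(m|n)$ is the restricted Lie superalgebra with matrix units $e_{ij}$, $1\le i,j\le m+n$, where $\mathfrak g_{\bar 0}=gl(m)\oplus gl(n)$ (block diagonal) with $p$-mapping $[p]$ the $p$-th matrix power. Put $\mathfrak g_1=\bigoplus_{i\le m<j}\mathbf Fe_{ij}$ and $\mathfrak g_{-1}=\bigoplus_{i\le m<j}\mathbf Fe_{ji}$, so $\mathfrak g=\mathfrak g_{-1}\oplus\mathfrak g_{\bar 0}\oplus\mathfrak g_1$, and $\mathfrak g^+=\mathfrak g_{\bar 0}+\mathfrak g_1$. $H$ is the span of the $e_{ii}$, and $\mathfrak N_0^+=\bigoplus_{i<j,\ e_{ij}\in\mathfrak g_{\bar 0}}\mathbf Fe_{ij}$. For $\chi\in\mathfrak g_{\bar 0}^*$, $u(\mathfrak g,\chi)$ is the quotient of $U(\mathfrak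 g)$ by the two-sided ideal generated by $x^p-x^{[p]}-\chi(x)^p1$, $x\in\mathfrak g_{\bar 0}$; similarly $u(\mathfrak g_{\bar 0},\chi)$, $u(\mathfrak g^+,\chi)$. A simple $u(\mathfrak g_{\bar 0},\chi)$-module $M$ is regarded as a $u(\mathfrak g^+,\chi)$-module by letting $\mathfrak g_1M=0$, and $Z^{\chi}(M)=u(\mathfrak g,\chi)\otimes_{u(\mathfrak g^+,\chi)}M$ (the graded baby Verma module); $M$ is identified with $1\otimes M$. A maximal vector $v\in M$ of weight $\lambda\in H^*$ is a nonzero vector with $\mathfrak N_0^+v=0$ and $hv=\lambda(h)v$ for $h\in H$. $e_1,\dots,e_l$ and $f_1,\dots,f_l$ ($l=mn$) denote the bases $\{e_{ij}\mid i\le m,\ j>m\}$ of $\mathfrak g_1$ and $\{e_{ij}\mid i>m,\ j\le m\}$ of $\mathfrak g_{-1}$, listed in the order of ascending heights of the corresponding roots. The scalar $f_1(\lambda)$ (not to be confused with the basis vector $f_1$) is well defined because $e_1\cdots e_lf_1\cdots f_l$ has weight $0$. Modules are $\mathbf Z_2$-graded; simple means no proper nonzero $\mathbf Z_2$-graded submodule. *)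

(* Defs.v *)
From HB Require Import structures.
From mathcomp Require Import all_boot all_order all_algebra.
From mathcomp Require Import boolp finmap monalg.

Set Implicit Arguments.
Unset Strict Implicit.
Unset Printing Implicit Defensive.

Import GRing.Theory.
Local Open Scope ring_scope.
Local Open Scope quotient_scope.

Inductive zspan_prop (V : zmodType) (S : V -> Prop) : V -> Prop :=
| zspan_in x : S x -> zspan_prop S x
| zspan_0 : zspan_prop S 0
| zspan_B x y : zspan_prop S x -> zspan_prop S y -> zspan_prop S (x - y).

Definition zspan (V : zmodType) (S : V -> Prop) : {pred V} :=
  fun x => `[< zspan_prop S x >].

Lemma zspanP (V : zmodType) (S : V -> Prop) x :
  reflect (zspan_prop S x) (x \in zspan S).
Proof. exact: asboolP. Qed.

Fact zspan_zmod_closed (V : zmodType) (S : V -> Prop) : zmod_closed (zspan S).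
Proof.
split=> [|x y /zspanP Sx /zspanP Sy]; apply/zspanP; first exact: zspan_0.
exact: zspan_B.
Qed.

HB.instance Definition _ (V : zmodType) (S : V -> Prop) :=
  GRing.isZmodClosed.Build V (zspan S) (zspan_zmod_closed S).

Lemma zspan_additive (V W : zmodType) (S : V -> Prop) (f : {additive V -> W})
    (T : zmodClosed W) :
  (forall x, S x -> f x \in T) -> forall x, x \in zspan S -> f x \in T.
Proof.
move=> fS x /zspanP; elim=> [{}x /fS //||{}x y _ fx _ fy].
  by rewrite raddf0 rpred0.
by rewrite raddfB rpredB.
Qed.

Section QuotientRing.
Variables (A : pzRingType) (S : A -> Prop).

Definition ideal : {pred A} :=
  zspan (fun z => exists a r b, S r /\ z = a * r * b).

HB.instance Definition _ := GRing.ZmodClosed.on ideal.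

Lemma ideal_gen r : S r -> r \in ideal.
Proof.
by move=> Sr; apply/zspanP/zspan_in; exists 1, r, 1; rewrite mul1r mulr1.
Qed.

Lemma idealMl a x : x \in ideal -> a * x \in ideal.
Proof.
apply: (@zspan_additive _ _ _ (GRing.mull_fun a idfun)) => _ [b [r [c [Sr ->]]]] /=.
by apply/zspanP/zspan_in; exists (a * b), r, c; rewrite !mulrA.
Qed.

Lemma idealMr a x : x \in ideal -> x * a \in ideal.
Proof.
apply: (@zspan_additive _ _ _ (GRing.mulr_fun a idfun)) => _ [b [r [c [Sr ->]]]] /=.
by apply/zspanP/zspan_in; exists b, r, (c * a); rewrite !mulrA.
Qed.

Definition quotr : Type := {ideal_quot ideal}.

HB.instance Definition _ := GRing.Zmodule.on quotr.
HB.instance Definition _ := Quotient.on quotr.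

(* Here and below, [locked] keeps unification from computing in quotients. *)
Definition quotr_pi : A -> quotr := locked (fun x => \pi_quotr x).

Lemma quotr_piE x y : (quotr_pi x == quotr_pi y) = (x - y \in ideal).
Proof. by rewrite /quotr_pi -lock Quotient.idealrBE. Qed.

Definition quotr_one : quotr := locked (quotr_pi 1).
Definition quotr_mul : quotr -> quotr -> quotr :=
  locked (fun x y => quotr_pi (repr x * repr y)).

Lemma quotr_piK (x : quotr) : quotr_pi (repr x) = x.
Proof. by rewrite /quotr_pi -lock reprK. Qed.

Fact quotr_pi_zmod : zmod_morphism quotr_pi.
Proof. by move=> x y; rewrite /quotr_pi -lock raddfB. Qed.

HB.instance Definition _ :=
  GRing.isZmodMorphism.Build A quotr quotr_pi quotr_pi_zmod.

Fact quotr_piM x y : quotr_pi (x * y) = quotr_mul (quotr_pi x) (quotr_pi y).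
Proof.
rewrite /quotr_mul -lock; apply/eqP; rewrite quotr_piE.
set x' := repr _; set y' := repr _.
have -> : x * y - x' * y' = (x - x') * y + x' * (y - y').
  by rewrite mulrBl mulrBr addrA subrK.
by apply: rpredD; [apply: idealMr|apply: idealMl]; rewrite -quotr_piE quotr_piK.
Qed.

Fact quotr_mulA : associative quotr_mul.
Proof.
by move=> x y z; rewrite -[x]quotr_piK -[y]quotr_piK -[z]quotr_piK -!quotr_piM mulrA.
Qed.
Fact quotr_mul1 : left_id quotr_one quotr_mul.
Proof. by move=> x; rewrite /quotr_one -lock -[x]quotr_piK -quotr_piM mul1r. Qed.
Fact quotr_mulr1 : right_id quotr_one quotr_mul.
Proof. by move=> x; rewrite /quotr_one -lock -[x]quotr_piK -quotr_piM mulr1. Qed.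
Fact quotr_mulDl : left_distributive quotr_mul +%R.
Proof.
move=> x y z; rewrite -[x]quotr_piK -[y]quotr_piK -[z]quotr_piK.
by rewrite -raddfD -!quotr_piM -raddfD mulrDl.
Qed.
Fact quotr_mulDr : right_distributive quotr_mul +%R.
Proof.
move=> x y z; rewrite -[x]quotr_piK -[y]quotr_piK -[z]quotr_piK.
by rewrite -raddfD -!quotr_piM -raddfD mulrDr.
Qed.

HB.instance Definition _ := GRing.Zmodule_isPzRing.Build quotr
  quotr_mulA quotr_mul1 quotr_mulr1 quotr_mulDl quotr_mulDr.

Fact quotr_pi_monoid : monoid_morphism quotr_pi.
Proof.
split=> [|x y]; last by rewrite quotr_piM.
by rewrite [RHS]/(GRing.one _) /= /quotr_one -lock.
Qed.

HB.instance Definition _ :=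
  GRing.isMonoidMorphism.Build A quotr quotr_pi quotr_pi_monoid.

Lemma quotr_pi_eq0 r : S r -> quotr_pi r = 0.
Proof.
by move=> /ideal_gen Sr; apply/eqP; rewrite -(raddf0 quotr_pi) quotr_piE subr0.
Qed.

Lemma quotr_pi_comm c : (forall a, GRing.comm c a) ->
  forall a, GRing.comm (quotr_pi c) a.
Proof.
by move=> cC a; rewrite -[a]quotr_piK /GRing.comm -!rmorphM (cC (repr a)).
Qed.

Section Lift.
Variables (B : pzRingType) (f : {rmorphism A -> B}).
Hypothesis fS : forall r, S r -> f r = 0.

(* [fS] is an argument, so that the morphism structure below can be inferred. *)
Definition quotr_lift of (forall r, S r -> f r = 0) : quotr -> B :=
  locked (fun x => f (repr x)).

Lemma ideal_ker x : x \in ideal -> f x = 0.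
Proof.
move/zspanP; elim=> [_ [a [r [b [/fS r0 ->]]]]||y z _ y0 _ z0].
- by rewrite !rmorphM r0 mulr0 mul0r.
- by rewrite rmorph0.
- by rewrite rmorphB y0 z0 subrr.
Qed.

Lemma quotr_liftE x : quotr_lift fS (quotr_pi x) = f x.
Proof.
apply/eqP; rewrite /quotr_lift -lock -subr_eq0 -rmorphB ideal_ker //.
by rewrite -quotr_piE quotr_piK.
Qed.

Fact quotr_lift_zmod : zmod_morphism (quotr_lift fS).
Proof.
move=> x y; rewrite -[x]quotr_piK -[y]quotr_piK -raddfB !quotr_liftE.
exact: raddfB.
Qed.
Fact quotr_lift_monoid : monoid_morphism (quotr_lift fS).
Proof.
split=> [|x y]; first by rewrite -(rmorph1 quotr_pi) quotr_liftE rmorph1.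
rewrite -[x]quotr_piK -[y]quotr_piK -rmorphM !quotr_liftE.
exact: rmorphM.
Qed.

HB.instance Definition _ :=
  GRing.isZmodMorphism.Build quotr B (quotr_lift fS) quotr_lift_zmod.
HB.instance Definition _ :=
  GRing.isMonoidMorphism.Build quotr B (quotr_lift fS) quotr_lift_monoid.
End Lift.
End QuotientRing.

Section MalgExtension.
Variables (K : choiceType) (G V : zmodType) (f : K -> {additive G -> V}).

Definition malg_ext (g : {malg G[K]}) : V := \sum_(k <- msupp g) f k g@_k.

Lemma malg_extEw (d : {fset K}) g : (msupp g `<=` d)%fset ->
  malg_ext g = \sum_(k <- d) f k g@_k.
Proof.
move=> le; rewrite /malg_ext (big_fset_incl _ le) //= => k _ /mcoeff_outdom ->.
exact: raddf0.
Qed.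

Lemma malg_extU k c : malg_ext (mkmalgU k c) = f k c.
Proof. by rewrite (malg_extEw msuppU_le) big_seq_fset1 mcoeffUU. Qed.

Fact malg_ext_zmod : zmod_morphism malg_ext.
Proof.
move=> x y; pose d := (msupp x `|` (msupp y `|` msupp (x - y)))%fset.
have lx : (msupp x `<=` d)%fset by apply: fsubsetUl.
have ly : (msupp y `<=` d)%fset by rewrite /d fsetUCA fsubsetUl.
have lxy : (msupp (x - y) `<=` d)%fset by rewrite /d fsetUA fsubsetUr.
rewrite (malg_extEw lx) (malg_extEw ly) (malg_extEw lxy) -sumrB.
by apply: eq_bigr => k _; rewrite mcoeffB raddfB.
Qed.

HB.instance Definition _ :=
  GRing.isZmodMorphism.Build {malg G[K]} V malg_ext malg_ext_zmod.
End MalgExtension.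

(* An [F]-algebra is a ring [B] with a morphism [eta : F -> B] of central image:
   MathComp's [algType] is restricted to nontrivial rings, and the quotients
   below are not known a priori to be nontrivial. *)
Section FreeAlgebraLift.
Variables (F : comNzRingType) (X : choiceType) (B : pzRingType).
Variables (eta : {rmorphism F -> B}) (h : X -> B).

Definition word_val (w : {fmonom X}) (c : F) : B := eta c * \prod_(x <- w) h x.

Fact word_val_zmod w : zmod_morphism (word_val w).
Proof. by move=> c d; rewrite /word_val rmorphB mulrBl. Qed.

HB.instance Definition _ w :=
  GRing.isZmodMorphism.Build F B (word_val w) (word_val_zmod w).

Hypothesis etaC : forall c b, GRing.comm (eta c) b.

Definition free_lift of (forall c b, GRing.comm (eta c) b) :
  {malg F[{fmonom X}]} -> B := malg_ext (fun w => word_val w).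

HB.instance Definition _ := GRing.Additive.on (free_lift etaC).

Lemma free_liftU w c : free_lift etaC (mkmalgU w c) = eta c * \prod_(x <- w) h x.
Proof. by rewrite /free_lift malg_extU. Qed.

Fact free_lift_monoid : monoid_morphism (free_lift etaC).
Proof.
split=> [|x y].
  by rewrite free_liftU rmorph1 mul1r fm1 big_nil.
rewrite malgME (raddf_sum (free_lift etaC)) mulr_suml; apply: eq_bigr => k1 _.
rewrite (raddf_sum (free_lift etaC)) mulr_sumr; apply: eq_bigr => k2 _.
rewrite /= free_liftU rmorphM fmM big_cat /= /word_val.
by rewrite -!mulrA; congr (_ * _); rewrite !mulrA; congr (_ * _); apply: etaC.
Qed.

HB.instance Definition _ :=
  GRing.isMonoidMorphism.Build _ B (free_lift etaC) free_lift_monoid.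

Lemma free_liftX x : free_lift etaC (mkmalgU (fmu x) 1) = h x.
Proof.
by rewrite free_liftU rmorph1 mul1r fmU big_seq1.
Qed.

Lemma free_liftC c : free_lift etaC (mkmalgU mone c) = eta c.
Proof. by rewrite free_liftU fm1 big_nil mulr1. Qed.
End FreeAlgebraLift.

Section TensorAlgebra.
Variables (F : comNzRingType) (V : lmodType F).

Definition tens_gen : V -> {malg F[{fmonom V}]} :=
  locked (fun x => mkmalgU (fmu x) 1).

Definition tens_rel (z : {malg F[{fmonom V}]}) : Prop :=
  exists c x y, z = tens_gen (c *: x + y) - (malgC c * tens_gen x + tens_gen y).

Definition tensor_algebra := quotr tens_rel.
HB.instance Definition _ := GRing.PzRing.on tensor_algebra.

Lemma malgC_comm (c : F) (g : {malg F[{fmonom V}]}) : GRing.comm (malgC c) g.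
Proof.
rewrite /GRing.comm mul_malgC malgM_def fgmulgU [g in LHS]monalgE scaler_sumr.
apply: eq_bigr => k _; rewrite mulm1; apply/malgP => k'.
by rewrite mcoeffZ !mcoeffU mulrnAr mulrC.
Qed.

Definition tens_in (x : V) : tensor_algebra := quotr_pi tens_rel (tens_gen x).
Definition tens_scalar : F -> tensor_algebra :=
  quotr_pi tens_rel \o @mkmalgU _ F (@mone {fmonom V}).
HB.instance Definition _ := GRing.RMorphism.on tens_scalar.

Lemma tens_in_linear c x y :
  tens_in (c *: x + y) = tens_scalar c * tens_in x + tens_in y.
Proof.
have /quotr_pi_eq0 /eqP : tens_rel (tens_gen (c *: x + y)
    - (malgC c * tens_gen x + tens_gen y)) by exists c, x, y.
by rewrite rmorphB rmorphD rmorphM subr_eq0 => /eqP.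
Qed.

Lemma tens_scalarC c a : GRing.comm (tens_scalar c) a.
Proof. exact: quotr_pi_comm (malgC_comm c) a. Qed.

Section Lift.
Variables (B : pzRingType) (eta : {rmorphism F -> B}) (h : V -> B).

Record tens_map : Prop := TensMap {
  tens_mapC : forall c b, GRing.comm (eta c) b;
  tens_mapL : forall c x y, h (c *: x + y) = eta c * h x + h y
}.

Hypothesis hP : tens_map.

Lemma tens_map_rel z : tens_rel z -> free_lift h (tens_mapC hP) z = 0.
Proof.
have gE x : free_lift h (tens_mapC hP) (tens_gen x) = h x.
  by rewrite /tens_gen -lock; apply: free_liftX.
move=> [c [x [y ->]]]; rewrite rmorphB rmorphD rmorphM /=.
by rewrite (gE (_ + _)) (gE x) (gE y) free_liftC (tens_mapL hP) subrr.
Qed.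

Definition tens_lift : tensor_algebra -> B :=
  quotr_lift tens_map_rel.
HB.instance Definition _ := GRing.RMorphism.on tens_lift.

Lemma tens_liftE x : tens_lift (tens_in x) = h x.
Proof. rewrite /tens_lift quotr_liftE /tens_gen -lock; exact: free_liftX. Qed.

Lemma tens_liftC c : tens_lift (tens_scalar c) = eta c.
Proof. rewrite /tens_lift quotr_liftE; exact: free_liftC. Qed.
End Lift.
End TensorAlgebra.

Definition restr (B C : pzRingType) (f : {rmorphism B -> C}) (M : lmodType C) : Type := M.

Section Restriction.
Variables (B C : pzRingType) (f : {rmorphism B -> C}) (M : lmodType C).

HB.instance Definition _ := GRing.Zmodule.on (restr f M).

Definition restr_scale (b : B) (x : restr f M) : restr f M := (f b *: (x : M))%R.

Fact restr_scaleA a b x : restr_scale a (restr_scale b x) = restr_scale (a * b) x.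
Proof. by rewrite /restr_scale scalerA rmorphM. Qed.
Fact restr_scale1 : left_id 1 restr_scale.
Proof. by move=> x; rewrite /restr_scale rmorph1 scale1r. Qed.
Fact restr_scaleDr : right_distributive restr_scale +%R.
Proof. by move=> b x y; rewrite /restr_scale scalerDr. Qed.
Fact restr_scaleDl x : {morph restr_scale^~ x : a b / a + b}.
Proof. by move=> a b; rewrite /restr_scale rmorphD scalerDl. Qed.

HB.instance Definition _ := GRing.Zmodule_isLmodule.Build B (restr f M)
  restr_scaleA restr_scale1 restr_scaleDr restr_scaleDl.

Lemma restr_scaleE b (x : M) : b *: (x : restr f M) = f b *: x :> M.
Proof. by []. Qed.
End Restriction.

Section TensorProduct.
Variables (A B : pzRingType) (f : {rmorphism B -> A}) (M : lmodType B).

(* [A] is a right [B]-module through [f]. *)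
Inductive tprod_rel : {malg int[(A * M)%type]} -> Prop :=
| tprod_relDl a a' x :
    tprod_rel (mkmalgU (a + a', x) 1 - (mkmalgU (a, x) 1 + mkmalgU (a', x) 1))
| tprod_relDr a x x' :
    tprod_rel (mkmalgU (a, x + x') 1 - (mkmalgU (a, x) 1 + mkmalgU (a, x') 1))
| tprod_relM a b x :
    tprod_rel (mkmalgU (a * f b, x) 1 - mkmalgU (a, b *: x) 1).

Definition tprod : Type := {ideal_quot (zspan tprod_rel)}.

HB.instance Definition _ := GRing.Zmodule.on tprod.
HB.instance Definition _ := Quotient.on tprod.

Definition tprod_pi : {malg int[(A * M)%type]} -> tprod :=
  locked (fun g => \pi_tprod g).

Definition tens : A -> M -> tprod :=
  locked (fun a x => tprod_pi (mkmalgU (a, x) 1)).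

Fact tprod_pi_zmod : zmod_morphism tprod_pi.
Proof. by move=> x y; rewrite /tprod_pi -lock raddfB. Qed.
HB.instance Definition _ :=
  GRing.isZmodMorphism.Build _ tprod tprod_pi tprod_pi_zmod.

Lemma tprod_piE x y : (tprod_pi x == tprod_pi y) = (x - y \in zspan tprod_rel).
Proof. by rewrite /tprod_pi -lock Quotient.idealrBE. Qed.

Lemma tprod_piK x : tprod_pi (repr x) = x.
Proof. by rewrite /tprod_pi -lock reprK. Qed.

Lemma tprod_pi_eq0 g : tprod_rel g -> tprod_pi g = 0.
Proof.
move=> gS; apply/eqP; rewrite -(raddf0 tprod_pi) tprod_piE subr0.
exact/zspanP/zspan_in.
Qed.

Lemma tensDl a a' x : tens (a + a') x = tens a x + tens a' x.
Proof.
have /eqP := tprod_pi_eq0 (tprod_relDl a a' x).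
by rewrite /tens -lock raddfB raddfD subr_eq0 => /eqP.
Qed.

Lemma tensDr a x x' : tens a (x + x') = tens a x + tens a x'.
Proof.
have /eqP := tprod_pi_eq0 (tprod_relDr a x x').
by rewrite /tens -lock raddfB raddfD subr_eq0 => /eqP.
Qed.

Lemma tens_balanced a b x : tens (a * f b) x = tens a (b *: x).
Proof.
have /eqP := tprod_pi_eq0 (tprod_relM a b x).
by rewrite /tens -lock raddfB subr_eq0 => /eqP.
Qed.

Definition tprod_free_scale (a : A) : {malg int[(A * M)%type]} -> {malg int[(A * M)%type]} :=
  malg_ext (fun k => @mkmalgU _ int (a * k.1, k.2)).
HB.instance Definition _ a := GRing.Additive.on (tprod_free_scale a).

Lemma tprod_free_scaleU a k n :
  tprod_free_scale a (mkmalgU k n) = mkmalgU (a * k.1, k.2) n.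
Proof. by rewrite /tprod_free_scale malg_extU. Qed.

Lemma tprod_free_scale_rel a x :
  x \in zspan tprod_rel -> tprod_free_scale a x \in zspan tprod_rel.
Proof.
apply: zspan_additive => _ [a1 a2 y|a1 y z|a1 b y];
  rewrite ?(raddfB (tprod_free_scale a)) ?(raddfD (tprod_free_scale a)) /=
    !tprod_free_scaleU /=; apply/zspanP/zspan_in.
- by rewrite mulrDr; apply: tprod_relDl.
- exact: tprod_relDr.
- by rewrite mulrA; apply: tprod_relM.
Qed.

(* [a *: tens b x = tens (a * b) x], see [tprod_scaleE]. *)
Definition tprod_scale : A -> tprod -> tprod :=
  locked (fun a z => tprod_pi (tprod_free_scale a (repr z))).

Lemma tprod_scale_pi a g : tprod_scale a (tprod_pi g) = tprod_pi (tprod_free_scale a g).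
Proof.
rewrite /tprod_scale -lock; apply/eqP; rewrite tprod_piE -raddfB.
apply: tprod_free_scale_rel.
by rewrite -tprod_piE tprod_piK.
Qed.

Lemma malg_additive_ext (K : choiceType) (V : zmodType)
    (u v : {additive {malg int[K]} -> V}) :
  (forall k, u (mkmalgU k 1) = v (mkmalgU k 1)) -> u =1 v.
Proof.
move=> uv g; rewrite [g]monalgE !raddf_sum; apply: eq_bigr => k _ /=.
have -> : mkmalgU k g@_k = mkmalgU k (1 : int) *~ g@_k.
  by rewrite -raddfMz /= intz.
by rewrite !raddfMz uv.
Qed.

Fact tprod_scaleA a b z : tprod_scale a (tprod_scale b z) = tprod_scale (a * b) z.
Proof.
rewrite -[z]tprod_piK !tprod_scale_pi; congr tprod_pi.
apply: (@malg_additive_ext _ _ (tprod_free_scale a \o tprod_free_scale b)) => k /=.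
by rewrite !tprod_free_scaleU /= mulrA.
Qed.
Fact tprod_scale1 : left_id 1 tprod_scale.
Proof.
move=> z; rewrite -[z]tprod_piK !tprod_scale_pi; congr tprod_pi.
apply: (@malg_additive_ext _ _ _ idfun) => -[a x] /=.
by rewrite !tprod_free_scaleU /= mul1r.
Qed.
Fact tprod_scaleDr : right_distributive tprod_scale +%R.
Proof.
move=> a y z; rewrite -[y]tprod_piK -[z]tprod_piK -raddfD !tprod_scale_pi.
by rewrite -raddfD -raddfD.
Qed.
Fact tprod_scaleDl z : {morph tprod_scale^~ z : a b / a + b}.
Proof.
move=> a b; rewrite -[z]tprod_piK !tprod_scale_pi -raddfD.
apply: (@malg_additive_ext _ _ (tprod_pi \o tprod_free_scale (a + b))
  (tprod_pi \o (tprod_free_scale a \+ tprod_free_scale b))) => -[c x] /=.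
rewrite !tprod_free_scaleU /= mulrDl; apply/eqP; rewrite tprod_piE.
by apply/zspanP/zspan_in; apply: tprod_relDl.
Qed.

HB.instance Definition _ := GRing.Zmodule_isLmodule.Build A tprod
  tprod_scaleA tprod_scale1 tprod_scaleDr tprod_scaleDl.

Lemma tprod_scaleE a b x : a *: tens b x = tens (a * b) x.
Proof.
by rewrite /tens -lock [LHS]tprod_scale_pi tprod_free_scaleU.
Qed.
End TensorProduct.

Section Graded.
Variables (A : pzRingType) (gA : bool -> {pred A}) (M : lmodType A).

(* [gM s] is the homogeneous component of parity [s], [true] being odd. *)
Definition graded_module (gM : bool -> {pred M}) : Prop :=
  [/\ forall s, zmod_closed (gM s),
      forall x, exists2 y, y \in gM false & x - y \in gM true,
      forall x, x \in gM false -> x \in gM true -> x = 0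
    & forall s t a x, a \in gA s -> x \in gM t -> a *: x \in gM (s (+) t)].

Definition graded_submodule (gM : bool -> {pred M}) (N : {pred M}) : Prop :=
  submod_closed N /\
  forall x, x \in N -> exists y z,
    [/\ y \in gM false, z \in gM true, y \in N, z \in N & x = y + z].

Definition simple_module (gM : bool -> {pred M}) : Prop :=
  (exists x : M, x != 0) /\
  forall N : {pred M}, graded_submodule gM N ->
    (forall x, x \in N -> x = 0) \/ (forall x, x \in N).
End Graded.

Section GeneralLinear.
Variables (F : fieldType) (m n : nat).
Local Notation gl_mx := 'M[F]_(m + n).
Implicit Types x y : gl_mx.

(* Indices start at 0: [low i] says that row [i] is one of the first [m]. *)
Definition low (i : 'I_(m + n)) : bool := (i < m)%N.

Definition mx_unit (ij : 'I_(m + n) * 'I_(m + n)) : gl_mx := delta_mx ij.1 ij.2.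

Definition span_units (P : pred ('I_(m + n) * 'I_(m + n))) : {vspace gl_mx} :=
  locked (\sum_(ij | P ij) <[mx_unit ij]>)%VS.

Definition in_gl0 : pred ('I_(m + n) * 'I_(m + n)) :=
  fun ij => low ij.1 == low ij.2.
Definition in_gl1 : pred ('I_(m + n) * 'I_(m + n)) :=
  fun ij => low ij.1 && ~~ low ij.2.
Definition in_glm1 : pred ('I_(m + n) * 'I_(m + n)) :=
  fun ij => ~~ low ij.1 && low ij.2.

Definition gl0 := span_units in_gl0.
Definition gl1 := span_units in_gl1.
Definition glm1 := span_units in_glm1.
Definition gl_plus := (gl0 + gl1)%VS.
Definition gl := span_units xpredT.
Definition cartan := span_units (fun ij => ij.1 == ij.2).
Definition nil0 := span_units (fun ij => (ij.1 < ij.2)%N && in_gl0 ij).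

Definition gl_parity (s : bool) : {vspace gl_mx} :=
  if s then (glm1 + gl1)%VS else gl0.

(* The bracket of [x] of parity [s] with [y] of parity [t]. *)
Definition sbracket (s t : bool) x y : gl_mx :=
  x *m y - (-1) ^+ (s && t) *: (y *m x).

Lemma span_unitsP P x :
  reflect (forall i j, ~~ P (i, j) -> x i j = 0) (x \in span_units P).
Proof.
rewrite /span_units -lock; apply: (iffP idP) => [/memv_sumP [z zP ->] i j nPij|xP].
  rewrite summxE big1 // => -[k l] Pkl.
  have /vlineP [c ->] := zP _ Pkl.
  rewrite !mxE /=; case: eqP => [ik|]; case: eqP => [jl|] //=; rewrite ?mulr0 //.
  by rewrite ik jl Pkl in nPij.
rewrite [x]matrix_sum_delta pair_big /= (bigID P) /= rpredD //.
  apply: rpred_sum => -[i j] Pij; apply: memvZ.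
  by rewrite memvE (sumv_sup (i, j)).
rewrite big1 ?mem0v // => -[i j] /= /xP ->; exact: scale0r.
Qed.

Lemma mem_gl x : x \in gl.
Proof. exact/span_unitsP. Qed.

Lemma gl_plusP x :
  reflect (forall i j, in_glm1 (i, j) -> x i j = 0) (x \in gl_plus).
Proof.
apply: (iffP memv_addP) => [[y /span_unitsP y0 [z /span_unitsP z1 ->]] i j|xP].
  rewrite /in_glm1 /= => /andP [li lj]; rewrite mxE y0 ?z1 ?addr0 //.
    by rewrite /in_gl1 /= (negPf li).
  by rewrite /in_gl0 /= (negPf li) lj.
exists (\matrix_(i, j) if low i == low j then x i j else 0).
  apply/span_unitsP => i j; rewrite /in_gl0 /= mxE.
  by move/negPf=> ->.
exists (\matrix_(i, j) if low i == low j then 0 else x i j).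
  apply/span_unitsP => i j; rewrite /in_gl1 mxE /=.
  case lij: (low i == low j) => //= nij; apply: xP.
  by move: nij lij; rewrite /in_glm1 /=; case: (low i); case: (low j).
apply/matrixP => i j; rewrite !mxE; case: ifP; by rewrite ?addr0 ?add0r.
Qed.

Lemma gl0_sub_plus : (gl0 <= gl_plus)%VS.
Proof. exact: addvSl. Qed.

Lemma gl_plusM x y : x \in gl_plus -> y \in gl_plus -> x *m y \in gl_plus.
Proof.
move=> /gl_plusP xP /gl_plusP yP; apply/gl_plusP => i j /andP [/= li lj].
rewrite mxE big1 // => k _; case lk: (low k).
  by rewrite xP ?mul0r // /in_glm1 /= li lk.
by rewrite yP ?mulr0 // /in_glm1 /= lk lj.
Qed.

Lemma sbracket_plus s t x y :
  x \in gl_plus -> y \in gl_plus -> sbracket s t x y \in gl_plus.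
Proof. by move=> xP yP; rewrite rpredB ?memvZ ?gl_plusM. Qed.

Lemma gl0M x y : x \in gl0 -> y \in gl0 -> x *m y \in gl0.
Proof.
move=> /span_unitsP xP /span_unitsP yP; apply/span_unitsP => i j /= nij.
rewrite mxE big1 // => k _; case lk: (low i == low k).
  rewrite yP ?mulr0 // /in_gl0 /= -(eqP lk); exact: nij.
by rewrite xP ?mul0r // /in_gl0 /= lk.
Qed.

Lemma gl0X p x : x \in gl0 -> x ^+ p \in gl0.
Proof.
move=> x0; elim: p => [|p IH]; last by rewrite exprS; apply: gl0M.
apply/span_unitsP => i j; rewrite /in_gl0 /= mxE.
by case: (i =P j) => [->|]; rewrite ?eqxx.
Qed.

(* The projection of [gl_plus] onto [gl0] with kernel [gl1]. *)
Definition diag_part x : gl_mx :=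
  \matrix_(i, j) if low i == low j then x i j else 0.

Fact diag_part_linear : linear diag_part.
Proof.
move=> c x y; apply/matrixP => i j; rewrite !mxE.
by case: ifP => _; rewrite ?mulr0 ?addr0.
Qed.
HB.instance Definition _ :=
  GRing.isLinear.Build F gl_mx gl_mx *:%R diag_part diag_part_linear.

Lemma diag_part_gl0 x : diag_part x \in gl0.
Proof. by apply/span_unitsP => i j; rewrite /in_gl0 /= mxE => /negPf ->. Qed.

Lemma diag_part_id x : x \in gl0 -> diag_part x = x.
Proof.
move/span_unitsP=> xP; apply/matrixP => i j; rewrite mxE.
by case: ifP => // /negP/negP nij; rewrite xP.
Qed.

Lemma diag_part_odd x : x \in gl_parity true -> diag_part x = 0.
Proof.
move=> /memv_addP [y /span_unitsP y0 [z /span_unitsP z1 ->]].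
apply/matrixP => i j; rewrite !mxE; case: ifP => // lij.
by rewrite y0 ?z1 ?addr0 // /in_gl1 /in_glm1 /= (eqP lij) ?andbN ?andNb.
Qed.

Lemma diag_partM x y : x \in gl_plus -> y \in gl_plus ->
  diag_part (x *m y) = diag_part x *m diag_part y.
Proof.
move=> /gl_plusP xP /gl_plusP yP; apply/matrixP => i j; rewrite !mxE.
case: ifP => lij; last first.
  rewrite big1 // => k _; rewrite !mxE; case: ifP => [/eqP lik|_].
    by rewrite -lik lij mulr0.
  by rewrite mul0r.
apply: eq_bigr => k _; rewrite !mxE -(eqP lij) [low k == _]eq_sym.
case lik: (low i == low k) => //; rewrite mul0r.
case li: (low i); move: lik lij; rewrite li; case lk: (low k) => //= _ /eqP lj.
  by rewrite yP ?mulr0 // /in_glm1 /= lk -lj.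
by rewrite xP ?mul0r // /in_glm1 /= lk li.
Qed.

Lemma diag_part_bracket s t x y : x \in gl_plus -> y \in gl_plus ->
  diag_part (sbracket s t x y) = sbracket s t (diag_part x) (diag_part y).
Proof. by move=> xP yP; rewrite /sbracket linearB linearZ /= !diag_partM. Qed.
End GeneralLinear.

Arguments gl {F m n}.
Arguments gl0 {F m n}.
Arguments gl1 {F m n}.
Arguments glm1 {F m n}.
Arguments gl_plus {F m n}.
Arguments cartan {F m n}.
Arguments nil0 {F m n}.
Arguments gl_parity {F m n} s.
Arguments mx_unit {F m n} ij.

Section Enveloping.
Variables (F : fieldType) (m n : nat) (W : {vspace 'M[F]_(m + n)}).
Implicit Types x y : 'M[F]_(m + n).

(* [vsproj W] is the inverse of the inclusion of [W], and is only meaningful on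
   [W]; so are the maps [tens_mx], [env_in] and [uenv_in] below. *)
Definition tens_mx x : tensor_algebra (subvs_of W) := tens_in (vsproj W x).

Definition env_rel (z : tensor_algebra (subvs_of W)) : Prop :=
  exists s t x y,
    [/\ x \in W /\ y \in W, x \in gl_parity s, y \in gl_parity t
      & z = tens_mx x * tens_mx y - (-1) ^+ (s && t) * (tens_mx y * tens_mx x)
            - tens_mx (sbracket s t x y)].

(* [U(W)], for a graded subalgebra [W] *)
Definition env := quotr env_rel.
HB.instance Definition _ := GRing.PzRing.on env.

Definition env_in x : env := quotr_pi env_rel (tens_mx x).
Definition env_scalar : F -> env :=
  quotr_pi env_rel \o @tens_scalar F (subvs_of W).
HB.instance Definition _ := GRing.RMorphism.on env_scalar.

Variables (p : nat) (chi : {scalar subvs_of (@gl0 F m n)}).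

Definition reduced_rel (z : env) : Prop :=
  exists x : subvs_of (@gl0 F m n),
    z = env_in (vsval x) ^+ p - env_in (vsval x ^+ p) - env_scalar (chi x ^+ p).

(* The algebra [u(W, chi)], for a graded subalgebra [W] containing [gl0]. The
   product of matrices is the multiplication of their ring, so that the p-mapping
   [x |-> x^[p]] is [x ^+ p]. *)
Definition uenv := quotr reduced_rel.
HB.instance Definition _ := GRing.PzRing.on uenv.

Definition uenv_in x : uenv := quotr_pi reduced_rel (env_in x).
Definition uenv_scalar : F -> uenv := quotr_pi reduced_rel \o env_scalar.
HB.instance Definition _ := GRing.RMorphism.on uenv_scalar.

(* The Z/2-grading of [u(W, chi)] inherited from [W] *)
Definition uenv_gr (s : bool) : {pred uenv} :=
  zspan (fun z => exists (c : F) (l : seq (bool * 'M[F]_(m + n))),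
    [/\ all (fun a => (a.2 \in W) && (a.2 \in gl_parity a.1)) l,
        \big[addb/false]_(a <- l) a.1 = s
      & z = uenv_scalar c * \prod_(a <- l) uenv_in a.2]).

Lemma tens_mx_linear c x y :
  tens_mx (c *: x + y) = tens_scalar _ c * tens_mx x + tens_mx y.
Proof. by rewrite /tens_mx linearP tens_in_linear. Qed.

Lemma env_in_linear c x y : env_in (c *: x + y) = env_scalar c * env_in x + env_in y.
Proof. by rewrite /env_in tens_mx_linear rmorphD rmorphM. Qed.

Lemma uenv_in_linear c x y :
  uenv_in (c *: x + y) = uenv_scalar c * uenv_in x + uenv_in y.
Proof. by rewrite /uenv_in env_in_linear rmorphD rmorphM. Qed.

Fact uenv_in_zmod : zmod_morphism uenv_in.
Proof.
move=> x y; have -> : x - y = (-1) *: y + x by rewrite scaleN1r addrC.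
by rewrite uenv_in_linear rmorphN1 mulN1r addrC.
Qed.
HB.instance Definition _ :=
  GRing.isZmodMorphism.Build _ uenv uenv_in uenv_in_zmod.

Lemma uenv_in_bracket s t x y : x \in W -> y \in W ->
  x \in gl_parity s -> y \in gl_parity t ->
  uenv_in x * uenv_in y - (-1) ^+ (s && t) * (uenv_in y * uenv_in x)
    = uenv_in (sbracket s t x y).
Proof.
move=> xW yW xs yt; rewrite /uenv_in /env_in.
have : env_rel (tens_mx x * tens_mx y - (-1) ^+ (s && t) * (tens_mx y * tens_mx x)
    - tens_mx (sbracket s t x y)) by exists s, t, x, y; split.
move: (tens_mx x) (tens_mx y) (tens_mx _) => a b c /quotr_pi_eq0 /eqP.
rewrite rmorphB subr_eq0 => /eqP <-.
by rewrite !rmorphB !rmorphM !rmorph_sign.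
Qed.

Lemma uenv_in_pmap (x : subvs_of (@gl0 F m n)) :
  uenv_in (vsval x) ^+ p - uenv_in (vsval x ^+ p) = uenv_scalar (chi x ^+ p).
Proof.
rewrite /uenv_in /uenv_scalar /= -rmorphXn -rmorphB; apply/eqP.
by rewrite quotr_piE; apply: ideal_gen; exists x.
Qed.

Lemma env_scalarC c (a : env) : GRing.comm (env_scalar c) a.
Proof. exact: quotr_pi_comm (tens_scalarC c) a. Qed.

Lemma uenv_scalarC c (a : uenv) : GRing.comm (uenv_scalar c) a.
Proof. exact: quotr_pi_comm (env_scalarC c) a. Qed.

Section Lift.
Variables (B : pzRingType) (eta : {rmorphism F -> B}).
Variable h : 'M[F]_(m + n) -> B.

Record uenv_map : Prop := UenvMap {
  uenv_mapC : forall c b, GRing.comm (eta c) b;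
  uenv_mapL : forall c x y, h (c *: x + y) = eta c * h x + h y;
  uenv_map_sub : (gl0 <= W)%VS;
  uenv_map_closed : forall s t x y, x \in W -> y \in W ->
    sbracket s t x y \in W;
  uenv_map_bracket : forall s t x y, x \in W -> y \in W ->
    x \in gl_parity s -> y \in gl_parity t ->
    h x * h y - (-1) ^+ (s && t) * (h y * h x) = h (sbracket s t x y);
  uenv_map_pmap : forall x : subvs_of (@gl0 F m n),
    h (vsval x) ^+ p - h (vsval x ^+ p) = eta (chi x ^+ p)
}.

Hypothesis hP : uenv_map.

Fact uenv_tens_map : tens_map eta (h \o @vsval _ _ W).
Proof.
split=> [|c x y]; first exact: uenv_mapC hP.
rewrite -[RHS](uenv_mapL hP); congr h; exact: linearP.
Qed.

Lemma tens_lift_mx x : x \in W -> tens_lift uenv_tens_map (tens_mx x) = h x.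
Proof. by move=> xW; rewrite /tens_mx tens_liftE /= vsprojK. Qed.

Lemma env_map_rel z : env_rel z -> tens_lift uenv_tens_map z = 0.
Proof.
move=> [s [t [x [y [[xW yW] xs yt ->]]]]].
rewrite !rmorphB !rmorphM rmorph_sign /= !tens_lift_mx //; last exact: uenv_map_closed hP _ _ _ _ _ _.
by rewrite (uenv_map_bracket hP) ?subrr.
Qed.

Definition env_lift : env -> B := quotr_lift env_map_rel.
HB.instance Definition _ := GRing.RMorphism.on env_lift.

Lemma env_liftE x : x \in W -> env_lift (env_in x) = h x.
Proof. by move=> xW; rewrite /env_lift quotr_liftE /= tens_lift_mx. Qed.

Lemma env_liftC c : env_lift (env_scalar c) = eta c.
Proof. by rewrite /env_lift quotr_liftE /= tens_liftC. Qed.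

Lemma uenv_map_rel z : reduced_rel z -> env_lift z = 0.
Proof.
move=> [x ->]; have W0 := subvP (uenv_map_sub hP).
rewrite !rmorphB rmorphXn /= env_liftC !env_liftE ?W0 ?gl0X ?subvsP //.
by rewrite (uenv_map_pmap hP) subrr.
Qed.

Definition uenv_lift : uenv -> B := quotr_lift uenv_map_rel.
HB.instance Definition _ := GRing.RMorphism.on uenv_lift.

Lemma uenv_liftE x : x \in W -> uenv_lift (uenv_in x) = h x.
Proof. by move=> xW; rewrite /uenv_lift quotr_liftE /= env_liftE. Qed.

Lemma uenv_liftC c : uenv_lift (uenv_scalar c) = eta c.
Proof. by rewrite /uenv_lift quotr_liftE /= env_liftC. Qed.
End Lift.
End Enveloping.

Arguments uenv_gr {F m n} W p chi s.

Section BabyVerma.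
Variables (F : fieldType) (m n p : nat) (chi : {scalar subvs_of (@gl0 F m n)}).

Fact uenv_incl_map : uenv_map gl_plus p chi (uenv_scalar gl p chi) (uenv_in gl p chi).
Proof.
split=> [||||s t x y _ _|x].
- exact: uenv_scalarC.
- exact: uenv_in_linear.
- exact: gl0_sub_plus.
- by move=> s t x y; apply: sbracket_plus.
- by apply: uenv_in_bracket; apply: mem_gl.
- exact: uenv_in_pmap.
Qed.

(* The morphism [u(gl_plus, chi) -> u(gl, chi)] induced by the inclusion *)
Definition uenv_incl : uenv gl_plus p chi -> uenv gl p chi :=
  uenv_lift uenv_incl_map.
HB.instance Definition _ := GRing.RMorphism.on uenv_incl.

Fact uenv_proj_map : uenv_map gl_plus p chi (uenv_scalar gl0 p chi)
  (uenv_in gl0 p chi \o @diag_part F m n).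
Proof.
split=> [||||s t x y xP yP xs yt|x] /=.
- exact: uenv_scalarC.
- by move=> c x y; rewrite linearP uenv_in_linear.
- exact: gl0_sub_plus.
- by move=> s t x y; apply: sbracket_plus.
- rewrite diag_part_bracket //.
  case: s xs => [/diag_part_odd ->|xs].
    by rewrite /sbracket mul0mx mulmx0 scaler0 subr0 raddf0 mul0r mulr0 mulr0 subr0.
  case: t yt => [/diag_part_odd ->|yt].
    by rewrite /sbracket mul0mx mulmx0 scaler0 subr0 raddf0 mul0r !mulr0 subr0.
  by apply: uenv_in_bracket; rewrite ?diag_part_gl0.
- by rewrite !diag_part_id ?gl0X ?subvsP // uenv_in_pmap.
Qed.

(* The morphism [u(gl_plus, chi) -> u(gl0, chi)] killing [gl1] *)
Definition uenv_proj : uenv gl_plus p chi -> uenv gl0 p chi :=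
  uenv_lift uenv_proj_map.
HB.instance Definition _ := GRing.RMorphism.on uenv_proj.

Lemma uenv_inclE x : x \in gl_plus ->
  uenv_incl (uenv_in gl_plus p chi x) = uenv_in gl p chi x.
Proof. exact: uenv_liftE. Qed.

Lemma uenv_projE x : x \in gl_plus ->
  uenv_proj (uenv_in gl_plus p chi x) = uenv_in gl0 p chi (diag_part x).
Proof. exact: uenv_liftE. Qed.

Variable M : lmodType (uenv gl0 p chi).

Definition baby_verma := tprod uenv_incl (restr uenv_proj M).
HB.instance Definition _ := GRing.Lmodule.on baby_verma.

(* The canonical map [x |-> 1 (x) x], by which [M] is identified with a subset
   of [baby_verma] *)
Definition bv_in (x : M) : baby_verma := tens uenv_incl 1 (x : restr uenv_proj M).

Lemma bv_in_gl1 x v : x \in gl1 -> uenv_in gl p chi x *: bv_in v = 0.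
Proof.
move=> x1; have xp : x \in gl_plus by apply: (subvP (addvSr _ _)).
rewrite /bv_in tprod_scaleE mulr1 -[uenv_in _ _ _ _]mul1r -uenv_inclE //.
rewrite tens_balanced; set w := _ *: _; have -> : w = 0.
  rewrite /w restr_scaleE /= uenv_projE // diag_part_odd ?raddf0 ?scale0r //.
  by apply: (subvP (addvSr _ _)).
by apply: (addrI (tens uenv_incl 1 (0 : restr uenv_proj M))); rewrite -tensDr !addr0.
Qed.

Lemma bv_in_gl0 x v :
  x \in gl0 -> uenv_in gl p chi x *: bv_in v = bv_in (uenv_in gl0 p chi x *: v).
Proof.
move=> x0; have xp : x \in gl_plus by apply: (subvP (gl0_sub_plus _ _ _)).
rewrite /bv_in tprod_scaleE mulr1 -[uenv_in _ _ _ _ in LHS]mul1r -uenv_inclE //.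
rewrite tens_balanced; congr (tens _ _ _).
by rewrite restr_scaleE /= uenv_projE // diag_part_id.
Qed.

Definition baby_verma_gr (gM : bool -> {pred M}) (s : bool) : {pred baby_verma} :=
  zspan (fun z => exists t a (x : M),
    [/\ a \in uenv_gr gl p chi t, x \in gM (s (+) t)
      & z = tens uenv_incl a (x : restr uenv_proj M)]).

Definition maximal_vector (lambda : {scalar subvs_of (@cartan F m n)}) (v : M) : Prop :=
  [/\ v != 0,
      forall x, x \in @nil0 F m n -> uenv_in gl0 p chi x *: v = 0
    & forall h : subvs_of (@cartan F m n),
        uenv_in gl0 p chi (vsval h) *: v = uenv_scalar gl0 p chi (lambda h) *: v].
End BabyVerma.

(* The height of the root of [e_ij], namely of [eps_i - eps_j] *)
Definition root_height (N : nat) (ij : 'I_N * 'I_N) : int :=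
  (ij.2 : nat)%:Z - (ij.1 : nat)%:Z.

(* [s] lists the indices in [P], each once, in the order of ascending heights;
   roots of the same height come in any order. *)
Definition ascending_listing (N : nat) (P : pred ('I_N * 'I_N))
    (s : seq ('I_N * 'I_N)) : Prop :=
  [/\ uniq s, s =i P & sorted (fun a b => root_height a <= root_height b) s].

(* Main.v *)
(* Let top be the product f_1 ... f_l. Applying suitable f's to a nonzero
   homogeneous element of a graded submodule N of Z yields top w in N with w
   homogeneous and nonzero in M; since gl0 acts on top by a character and M is
   simple, top M lies in N. Then e_1 ... e_l maps top v to f1(lambda) v, so if
   f1(lambda) <> 0 then N contains M, and N = Z. Conversely, the elements z such
   that pr(x_1 ... x_k z) = 0 for all x_i in gl1, where pr : Z -> M is the degree
   zero coefficient, form a proper graded submodule, and it contains top v <> 0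
   when f1(lambda) = 0. That pr exists and top v <> 0 is a PBW statement; it is
   obtained by letting u(gl, chi) act on Lambda(glm1) (x) M through explicit
   creation and annihilation operators. *)

(* The algebra [uenv] is given by generators and relations and might collapse a priori, so every
   independence statement has to come from a model. The delicate point of the model is to verify the
   relations for operators such as [osc_1], which contain double sums. The way around it: an
   operator that commutes up to one global sign with all creation operators vanishes as soon as it
   kills the vacuum. Hence only brackets with creation operators are computed by hand; the other
   brackets follow by induction on the degree, and the relation for $p$-th powers follows from
   $\mathrm{ad}(x^p)=\mathrm{ad}(x)^p$. The vacuum expectation turns each operator into an additive
   map from Z to M, and two such maps carry all the independence: one is [pr], the other detects the
   top component. A second concern is parity. Simplicity tests graded submodules only, whereas the
   maximal vector is not assumed homogeneous, so both implications split it into its even and odd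
   parts. *)
From HB Require Import structures.
Require Import Defs.
From mathcomp Require Import all_boot all_order all_algebra.
From mathcomp Require Import boolp monalg.

Set Implicit Arguments.
Unset Strict Implicit.
Unset Printing Implicit Defensive.

Import GRing.Theory.
Local Open Scope ring_scope.

(** * Fermionic Fock spaces *)

(* A superspace of states over [A] generated from a vacuum by the odd creation
   operators [fk_cr a], [a \in s], with annihilation operators [fk_an a] and the
   canonical anticommutation relations. [fk_exp] is the vacuum expectation value;
   it is what makes PBW-type independence statements provable. *)
Record fock (A : pzRingType) (I : eqType) (s : seq I) := Fock {
  fk_ring : pzRingType;
  fk_in : {rmorphism A -> fk_ring};
  fk_cr : I -> fk_ring;
  fk_an : I -> fk_ring;
  fk_exp : {additive fk_ring -> A};
  fk_center : forall u, (forall w, GRing.comm u w) -> forall b, GRing.comm (fk_in u) b;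
  fk_crC : forall u a, GRing.comm (fk_in u) (fk_cr a);
  fk_anC : forall u a, GRing.comm (fk_in u) (fk_an a);
  fk_crcr : forall a b, a \in s -> b \in s ->
    fk_cr a * fk_cr b = - (fk_cr b * fk_cr a);
  fk_anan : forall a b, a \in s -> b \in s ->
    fk_an a * fk_an b = - (fk_an b * fk_an a);
  fk_cr2 : forall a, a \in s -> fk_cr a * fk_cr a = 0;
  fk_an2 : forall a, a \in s -> fk_an a * fk_an a = 0;
  fk_ancr : forall a b, a \in s -> b \in s ->
    fk_an a * fk_cr b = (a == b)%:R - fk_cr b * fk_an a;
  fk_exp1 : fk_exp 1 = 1;
  fk_expMr : forall b u, fk_exp (b * fk_in u) = fk_exp b * u;
  fk_expMl : forall u b, fk_exp (fk_in u * b) = u * fk_exp b;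
  fk_exp_an : forall b a, a \in s -> fk_exp (b * fk_an a) = 0;
  fk_exp_cr : forall b a, a \in s -> fk_exp (fk_cr a * b) = 0
}.

(* Adding one mode by the Jordan-Wigner construction: the old operators act as
   [diag(x, -x)], the new ones as the two off-diagonal matrix units. *)
Section FockCons.
Variables (A : pzRingType) (I : eqType) (s : seq I) (K : fock A s) (a0 : I).
Local Notation B := (fk_ring K).
Local Notation B2 := 'M[B]_2.

Definition mx2 (a b c d : B) : B2 :=
  \matrix_(i, j) if i == 0 then (if j == 0 then a else b) else (if j == 0 then c else d).

Lemma mx2E (x : B2) : x = mx2 (x 0 0) (x 0 1) (x 1 0) (x 1 1).
Proof.
apply/matrixP => i j; rewrite mxE.
by case: i j => [[|[|//]] i] [[|[|//]] j] /=; congr (x _ _); apply: val_inj.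
Qed.

Lemma mx2M a b c d a' b' c' d' :
  mx2 a b c d * mx2 a' b' c' d'
  = mx2 (a * a' + b * c') (a * b' + b * d') (c * a' + d * c') (c * b' + d * d').
Proof.
apply/matrixP => i j; rewrite !mxE big_ord_recl big_ord1 !mxE /=.
by case: (i == 0); case: (j == 0).
Qed.

Lemma mx2D a b c d a' b' c' d' :
  mx2 a b c d + mx2 a' b' c' d' = mx2 (a + a') (b + b') (c + c') (d + d').
Proof. by apply/matrixP => i j; rewrite !mxE; case: (i == 0); case: (j == 0). Qed.

Lemma mx2N a b c d : - mx2 a b c d = mx2 (- a) (- b) (- c) (- d).
Proof. by apply/matrixP => i j; rewrite !mxE; case: (i == 0); case: (j == 0). Qed.

Lemma mx2_0 : 0 = mx2 0 0 0 0.
Proof. by apply/matrixP => i j; rewrite !mxE; case: (i == 0); case: (j == 0). Qed.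

Lemma mx2_1 : 1 = mx2 1 0 0 1.
Proof. by rewrite [LHS]mx2E !mxE. Qed.

Definition fc_in (u : A) : B2 := mx2 (fk_in K u) 0 0 (fk_in K u).

Fact fc_in_zmod : zmod_morphism fc_in.
Proof. by move=> u w; rewrite /fc_in mx2N mx2D rmorphB subr0. Qed.
Fact fc_in_monoid : monoid_morphism fc_in.
Proof.
split=> [|u w]; first by rewrite /fc_in rmorph1 -mx2_1.
by rewrite /fc_in mx2M rmorphM !(mul0r, mulr0, addr0, add0r).
Qed.
HB.instance Definition _ := GRing.isZmodMorphism.Build A B2 fc_in fc_in_zmod.
HB.instance Definition _ := GRing.isMonoidMorphism.Build A B2 fc_in fc_in_monoid.

(** The first coordinate holds the states with the new mode empty, the second those with it filled.
    The sign on the second makes old and new operators anticommute. *)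
Definition fc_cr (a : I) : B2 :=
  if a == a0 then mx2 0 0 1 0 else mx2 (fk_cr K a) 0 0 (- fk_cr K a).
Definition fc_an (a : I) : B2 :=
  if a == a0 then mx2 0 1 0 0 else mx2 (fk_an K a) 0 0 (- fk_an K a).
Definition fc_exp (x : B2) : A := fk_exp K (x 0 0).

Fact fc_exp_zmod : zmod_morphism fc_exp.
Proof. by move=> x y; rewrite /fc_exp !mxE raddfB. Qed.
HB.instance Definition _ := GRing.isZmodMorphism.Build B2 A fc_exp fc_exp_zmod.

Local Notation simp := (mul0r, mulr0, addr0, add0r, mul1r, mulr1, oppr0, mulrN, mulNr, opprK, subr0, sub0r).

Definition fock_cons : fock A (a0 :: s).
Proof.
have inP a : a \in a0 :: s -> a != a0 -> a \in s.
  by rewrite inE => /orP [->|].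
apply: (@Fock _ _ _ B2 fc_in fc_cr fc_an fc_exp) => /=.
- move=> u uC b; rewrite /GRing.comm [b]mx2E /fc_in !mx2M !simp.
  by congr mx2; apply: fk_center.
- move=> u a; rewrite /GRing.comm /fc_in /fc_cr; case: eqP => _; rewrite !mx2M !simp //.
  by rewrite fk_crC.
- move=> u a; rewrite /GRing.comm /fc_in /fc_an; case: eqP => _; rewrite !mx2M !simp //.
  by rewrite fk_anC.
- move=> a b /inP as_ /inP bs_; rewrite /fc_cr.
  case: eqVneq as_ => [_ _|_ /(_ isT) as_]; case: eqVneq bs_ => [_ _|_ /(_ isT) bs_];
  rewrite !mx2M mx2N !simp //.
  by rewrite fk_crcr.
- move=> a b /inP as_ /inP bs_; rewrite /fc_an.
  case: eqVneq as_ => [_ _|_ /(_ isT) as_]; case: eqVneq bs_ => [_ _|_ /(_ isT) bs_];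
  rewrite !mx2M mx2N !simp //.
  by rewrite fk_anan.
- move=> a /inP as_; rewrite /fc_cr.
  case: eqVneq as_ => [_ _|_ /(_ isT) as_]; rewrite !mx2M !simp ?mx2_0 //.
  by rewrite fk_cr2.
- move=> a /inP as_; rewrite /fc_an.
  case: eqVneq as_ => [_ _|_ /(_ isT) as_]; rewrite !mx2M !simp ?mx2_0 //.
  by rewrite fk_an2.
- move=> a b /inP as_ /inP bs_; rewrite /fc_an /fc_cr.
  case: (eqVneq a a0) as_ => [-> _|na /(_ isT) as_];
    case: (eqVneq b a0) bs_ => [-> _|nb /(_ isT) bs_].
  + by rewrite mx2_1 !mx2M mx2N mx2D !simp subrr.
  + by rewrite !mx2M mx2N !simp //.
  + by rewrite (negPf na) !mx2M mx2N !simp.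
  + rewrite !mx2M mx2N !simp fk_ancr //; case: (a == b); last by rewrite !simp.
    by rewrite mx2_1 mx2D !simp.
- by rewrite /fc_exp mxE fk_exp1.
- move=> b u; rewrite /fc_exp [b]mx2E /fc_in mx2M !mxE /= !simp; exact: fk_expMr.
- move=> u b; rewrite /fc_exp [b]mx2E /fc_in mx2M !mxE /= !simp; exact: fk_expMl.
- move=> b a /inP as_; rewrite /fc_exp [b]mx2E /fc_an.
  case: eqVneq as_ => [_ _|_ /(_ isT) as_]; rewrite mx2M !mxE /= !simp ?raddf0 //.
  exact: fk_exp_an.
- move=> b a /inP as_; rewrite /fc_exp [b]mx2E /fc_cr.
  case: eqVneq as_ => [_ _|_ /(_ isT) as_]; rewrite mx2M !mxE /= !simp ?raddf0 //.
  exact: fk_exp_cr.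
Defined.
End FockCons.

Definition fock_nil (A : pzRingType) (I : eqType) : fock A ([::] : seq I).
Proof.
apply: (@Fock _ _ _ A idfun (fun=> 0) (fun=> 0) idfun) => //=;
  by move=> *; rewrite /GRing.comm ?mulr0 ?mul0r.
Defined.

Fixpoint fock_space (A : pzRingType) (I : eqType) (s : seq I) : fock A s :=
  if s is a :: s' then fock_cons (fock_space A s') a else fock_nil A I.

(** * The vacuum projector *)

Section Vacuum.
Variables (A : pzRingType) (I : eqType) (s : seq I) (K : fock A s).
Local Notation B := (fk_ring K).
Local Notation xi := (fk_cr K).
Local Notation dd := (fk_an K).

(** Each factor equals $1-\xi_a d_a$, the projector onto the states with mode $a$ empty. For [t]
    equal to [s] the product plays the role of the projector onto the vacuum. *)
Definition vacuum (t : seq I) : B := \prod_(a <- t) (dd a * xi a).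

Lemma an_vacuumC t a : {subset t <= s} -> a \in s -> a \notin t ->
  dd a * vacuum t = vacuum t * dd a.
Proof.
rewrite /vacuum; elim: t => [|b t IH] ts as_; first by rewrite big_nil mulr1 mul1r.
have bs : b \in s by rewrite ts ?mem_head.
rewrite inE negb_or big_cons => /andP [nab /IH IHt].
rewrite mulrA [dd a * (_ * _)]mulrA fk_anan // mulNr -mulrA fk_ancr // (negPf nab) sub0r.
rewrite mulrN opprK mulrA -!mulrA IHt // => c ct; rewrite ts // inE ct orbT //.
Qed.

Lemma an_vacuum t a : {subset t <= s} -> a \in t -> dd a * vacuum t = 0.
Proof.
rewrite /vacuum; elim: t => [//|b t IH] ts ain.
have bs : b \in s by rewrite ts ?mem_head.
have as_ : a \in s by apply: ts.
rewrite big_cons; case: (eqVneq a b) ain => [-> _|nab].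
  by rewrite !mulrA fk_an2 // !mul0r.
rewrite inE (negPf nab) /= => /IH IHt.
rewrite mulrA [dd a * (_ * _)]mulrA fk_anan // mulNr -mulrA fk_ancr // (negPf nab) sub0r.
by rewrite mulrN opprK mulrA -mulrA IHt ?mulr0 // => c ct; rewrite ts // inE ct orbT.
Qed.

Lemma fk_in_vacuum u t : GRing.comm (fk_in K u) (vacuum t).
Proof.
apply: big_ind => [|x y|a _]; first exact: commr1; first exact: commrM.
by apply: commrM; [apply: fk_anC|apply: fk_crC].
Qed.

(* An operator is determined by its action on the vacuum and its
   (anti)commutators with the creation operators. *)
Lemma vacuum_eq0 (e : bool) c t : uniq t -> {subset t <= s} ->
  (forall a, a \in t -> c * xi a = (-1) ^+ e * (xi a * c)) ->
  c * vacuum t = 0 -> c = 0.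
Proof.
rewrite /vacuum; elim: t => [|a t IH] /=; first by rewrite big_nil mulr1.
move=> /andP [nat ut] ts cC; rewrite big_cons => c0.
have as_ : a \in s by rewrite ts ?mem_head.
have tss : {subset t <= s} by move=> b bt; rewrite ts // inE bt orbT.
apply: IH => // [b bt|]; first by rewrite cC // inE bt orbT.
(* Insert $1=d_a\xi_a+\xi_a d_a$ before [V]. The first term is the hypothesis. In the second,
   writing $\xi_a=\xi_a d_a\xi_a$ lets [c] pass $\xi_a$ up to sign; since $d_a$ commutes with [V],
   the hypothesis applies again. *)
have one : dd a * xi a + xi a * dd a = 1 by rewrite fk_ancr // eqxx subrK.
have xiE : xi a = xi a * (dd a * xi a).
  by rewrite fk_ancr // eqxx mulrBr mulr1 mulrA fk_cr2 // mul0r subr0.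
have dV := an_vacuumC tss as_ nat; rewrite /vacuum in dV.
move: (\prod_(_ <- t) _) c0 dV => V c0 dV.
rewrite -[V]mul1r -one mulrDl mulrDr c0 add0r {1}xiE -!mulrA dV.
rewrite mulrA cC ?mem_head // -!mulrA [xi a * (V * _)]mulrA [dd a * _]mulrA mulrA.
by rewrite (mulrA (dd a)) (mulrA c) c0 mul0r !mulr0.
Qed.
End Vacuum.

(** * Supercommutators *)

Section SuperCommutator.
Variable R : pzRingType.
Implicit Types x y z : R.

Definition scom (e : bool) x y : R := x * y - (-1) ^+ e * (y * x).

Lemma scomC e x y : scom e y x = - ((-1) ^+ e * scom e x y).
Proof.
rewrite /scom; case: e; rewrite ?expr0 ?expr1 ?mulN1r ?mul1r ?opprK //.
  exact: addrC.
by rewrite opprB.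
Qed.

Lemma scom_trueE x y : scom true x y = x * y + y * x.
Proof. by rewrite /scom expr1 mulN1r opprK. Qed.

Lemma scomDl e x x' y : scom e (x + x') y = scom e x y + scom e x' y.
Proof. by rewrite /scom mulrDl !mulrDr opprD addrACA. Qed.

Lemma scomBl e x x' y : scom e (x - x') y = scom e x y - scom e x' y.
Proof. by rewrite /scom mulrBl !mulrBr opprD addrACA -opprD. Qed.

Lemma scom_jacobi s t u x y z :
  scom ((s (+) t) && u) (scom (s && t) x y) z
  = scom (s && (t (+) u)) x (scom (t && u) y z)
    - (-1) ^+ (s && t) * scom (t && (s (+) u)) y (scom (s && u) x z).
Proof.
(* The left side consists of [a], [e], [f], [d]; the products [b] $=\pm xzy$ and [c] $=\pm yzx$
   occur only on the right, where they cancel. *)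
have six (V : zmodType) (a b c d e f : V) :
    (a - e) - (f - d) = ((a - b) - (c - d)) - ((e - c) - (b - f)).
  by rewrite !opprB [in RHS]addrACA !subrKA addrACA [RHS]addrACA [- f - e]addrC.
pose sg b : R := (-1) ^+ b.
have := six _ (x * y * z) (sg (t && u) * (x * z * y))
  (sg ((s && t) (+) (s && u)) * (y * z * x))
  (sg ((s && t) (+) (s && u) (+) (t && u)) * (z * y * x)) (sg (s && t) * (y * x * z))
  (sg ((s && u) (+) (t && u)) * (z * x * y)).
rewrite /scom /sg; case: s t u => [] [] [] /=;
  rewrite ?expr0 ?expr1 ?mulN1r ?mul1r;
  rewrite ?(mulrBr, mulrBl, mulrDl, mulrDr, opprD, mulNr, mulrN, mulrA, opprK) //.
Qed.

Lemma ad_expr x y k :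
  x ^+ k * y = \sum_(i < k.+1) iter i (scom false x) y * x ^+ (k - i) *+ 'C(k, i).
Proof.
have adE z : x * z = scom false x z + z * x by rewrite /scom mul1r subrK.
elim: k => [|k IH]; first by rewrite big_ord_recl big_ord0 addr0 mul1r mulr1.
rewrite exprS -mulrA {}IH big_distrr /=.
have -> : \sum_(i < k.+1) x * (iter i (scom false x) y * x ^+ (k - i) *+ 'C(k, i))
  = \sum_(i < k.+1) (iter i.+1 (scom false x) y * x ^+ (k - i) *+ 'C(k, i))
  + \sum_(i < k.+1) (iter i (scom false x) y * x ^+ (k.+1 - i) *+ 'C(k, i)).
  rewrite -big_split; apply: eq_bigr => i _ /=.
  by rewrite mulrnAr mulrA adE mulrDl mulrnDl -mulrA -exprS subSn // -ltnS.
rewrite big_ord_recr [X in _ + X]big_ord_recl [in RHS]big_ord_recl /=.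
rewrite [X in _ = _ + X]big_ord_recr /= /bump /= !add1n !binn !subnn !bin0.
rewrite addrCA; congr (_ + _); rewrite addrAC; congr (_ + _).
rewrite -big_split; apply: eq_bigr => i _ /=.
by rewrite /bump /= add1n subSS binS mulrnDr addrC.
Qed.

(** The inner binomial coefficients in [ad_expr] are divisible by $p$. This gives the commutator of
    a $p$-th power with a creation operator without expanding that power. *)
Lemma ad_exprp p x y : prime p -> (forall z, z *+ p = 0) ->
  scom false (x ^+ p) y = iter p (scom false x) y.
Proof.
case: p => [//|p] pp p0; rewrite {1}/scom mul1r ad_expr big_ord_recl big_ord_recr /=.
rewrite big1 => [|i _].
  by rewrite bin0 subn0 add0r /bump /= add1n binn subnn mulr1 !mulr1n [y * _ + _]addrC addrK.
rewrite /bump /= add1n.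
have /dvdnP [q ->] : (p.+1 %| 'C(p.+1, i.+1))%N by rewrite prime_dvd_bin //= ltnS ltn_ord.
by rewrite mulnC mulrnA p0 mul0rn.
Qed.
End SuperCommutator.

(** * The graded pieces of $gl(m|n)$ and their brackets *)

Section MatrixPieces.
Variables (F : fieldType) (m n : nat).
Local Notation gl_mx := 'M[F]_(m + n).
Local Notation I := ('I_(m + n) * 'I_(m + n))%type.
Implicit Types (x y z : gl_mx) (P Q T : pred I).

Lemma span_unitsM P Q T x y : (forall i k j, P (i, k) -> Q (k, j) -> T (i, j)) ->
  x \in span_units F P -> y \in span_units F Q -> x * y \in span_units F T.
Proof.
move=> PQT /span_unitsP xP /span_unitsP yQ; apply/span_unitsP => i j nT.
rewrite mxE big1 // => k _; case Pik: (P (i, k)); last by rewrite xP ?mul0r ?Pik.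
case Qkj: (Q (k, j)); last by rewrite yQ ?mulr0 ?Qkj.
by rewrite (PQT i k j) in nT.
Qed.

Lemma span_units_pred0 x : x \in span_units F (pred0 : pred I) -> x = 0.
Proof. by move=> /span_unitsP x0; apply/matrixP => i j; rewrite x0 // mxE. Qed.

Lemma mx_unit_span P a : P a -> mx_unit a \in span_units F P.
Proof.
move=> Pa; apply/span_unitsP => i j nP; rewrite /mx_unit mxE.
case: eqP => //= ia; case: eqP => //= ja; move: nP.
by rewrite ia ja -surjective_pairing Pa.
Qed.

Lemma span_units_expand P (us : seq I) y : uniq us -> us =i P -> y \in span_units F P ->
  y = \sum_(a <- us) y a.1 a.2 *: mx_unit a.
Proof.
move=> us_uniq usE /span_unitsP yP; rewrite {1}[y]matrix_sum_delta pair_big /=.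
rewrite (bigID (mem us)) /= [X in _ + X]big1 => [|[i j] ij]; last first.
  by rewrite yP ?scale0r // -[P _]/((i, j) \in P) -usE.
by rewrite addr0 [RHS]big_uniq.
Qed.

Lemma scom_linearl e z (c : F) x y :
  scom e (c *: x + y) z = c *: scom e x z + scom e y z.
Proof.
rewrite scomDl; congr (_ + _); rewrite /scom scalerBr.
rewrite [c *: x * z](esym (scalemxAl c x z)) [z * (c *: x)](esym (scalemxAr c z x)).
by congr (_ - _); case: e; rewrite ?mulN1r ?scalerN ?mul1r.
Qed.

Lemma scom_linearr e z (c : F) x y :
  scom e z (c *: x + y) = c *: scom e z x + scom e z y.
Proof.
rewrite !(scomC e _ z) scom_linearl mulrDr opprD; congr (_ + _).
by case: e; rewrite ?mulN1r ?scalerN ?mul1r ?opprK.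
Qed.

Lemma sbracketE s t x y : sbracket s t x y = scom (s && t) x y.
Proof. by rewrite /sbracket /scom; case: (s && t); rewrite ?scaleN1r ?mulN1r ?scale1r ?mul1r. Qed.

Lemma scom_span e P Q T x y :
  (forall i k j, P (i, k) -> Q (k, j) -> T (i, j)) ->
  (forall i k j, Q (i, k) -> P (k, j) -> T (i, j)) ->
  x \in span_units F P -> y \in span_units F Q -> scom e x y \in span_units F T.
Proof.
move=> PQ QP xP yQ; have yx := span_unitsM QP yQ xP.
apply: rpredB; first exact: span_unitsM PQ xP yQ.
by case: e; [rewrite expr1 mulN1r rpredN|rewrite expr0 mul1r].
Qed.

Local Ltac low_cases := rewrite /in_gl0 /in_gl1 /in_glm1 /= => ? ? ?;
  by do 3?case: (low _).

Lemma scom00 e x y : x \in gl0 -> y \in gl0 -> scom e x y \in gl0.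
Proof. by apply: scom_span; low_cases. Qed.
Lemma scom0N e x y : x \in gl0 -> y \in glm1 -> scom e x y \in glm1.
Proof. by apply: scom_span; low_cases. Qed.
Lemma scom01 e x y : x \in gl0 -> y \in gl1 -> scom e x y \in gl1.
Proof. by apply: scom_span; low_cases. Qed.
Lemma scom1N e x y : x \in gl1 -> y \in glm1 -> scom e x y \in gl0.
Proof. by apply: scom_span; low_cases. Qed.
(** Already the product of two elements of [gl1] vanishes, so the sign [e] is arbitrary; likewise
    for [glm1] below. *)
Lemma scom11 e x y : x \in gl1 -> y \in gl1 -> scom e x y = 0.
Proof. by move=> x1 y1; apply: span_units_pred0; apply: scom_span x1 y1; low_cases. Qed.
Lemma scomNN e x y : x \in glm1 -> y \in glm1 -> scom e x y = 0.
Proof. by move=> x1 y1; apply: span_units_pred0; apply: scom_span x1 y1; low_cases. Qed.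
Lemma scom10 e x y : x \in gl1 -> y \in gl0 -> scom e x y \in gl1.
Proof. by apply: scom_span; low_cases. Qed.

Definition up_part x : gl_mx := \matrix_(i, j) if in_gl1 (i, j) then x i j else 0.

Fact up_part_linear : linear up_part.
Proof.
move=> c x y; apply/matrixP => i j; rewrite !mxE.
by case: ifP => _; rewrite ?mulr0 ?addr0.
Qed.
HB.instance Definition _ := GRing.isLinear.Build F gl_mx gl_mx *:%R up_part up_part_linear.

Lemma up_part_gl1 x : up_part x \in gl1.
Proof. by apply/span_unitsP => i j /negPf; rewrite mxE => ->. Qed.

Lemma up_part_id x : x \in gl1 -> up_part x = x.
Proof.
move=> /span_unitsP xP; apply/matrixP => i j; rewrite mxE.
by case: ifP => // /negP/negP /xP.
Qed.

Lemma up_part_eq0 P x : x \in span_units F P -> (forall a, P a -> ~~ in_gl1 a) ->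
  up_part x = 0.
Proof.
move=> /span_unitsP xP PP; apply/matrixP => i j; rewrite !mxE.
by case: ifP => // ij; apply: xP; apply: contraL ij; apply: PP.
Qed.

Lemma diag_part_eq0 P x : x \in span_units F P -> (forall a, P a -> ~~ in_gl0 a) ->
  diag_part x = 0.
Proof.
move=> /span_unitsP xP PP; apply/matrixP => i j; rewrite !mxE.
by case: ifP => // ij; apply: xP; apply/negP => /PP; rewrite /in_gl0 /= ij.
Qed.
End MatrixPieces.

Lemma pchar_mulrn_mx (F : fieldType) (N p : nat) (z : 'M[F]_N) : p \in [pchar F] -> z *+ p = 0.
Proof. by move=> pF; rewrite -scaler_nat (pcharf0 pF) scale0r. Qed.

(** * Generators of tensor products and enveloping algebras *)

Lemma malg_ind (G : zmodType) (K : choiceType) (Q : {malg G[K]} -> Prop) :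
  Q 0 -> (forall x y, Q x -> Q y -> Q (x + y)) -> (forall k c, Q (mkmalgU k c)) ->
  forall g, Q g.
Proof. by move=> Q0 QD QU g; rewrite [g]monalgE; apply: big_ind. Qed.

Lemma free_algebra_ind (F : comNzRingType) (X : choiceType) (Q : {malg F[{fmonom X}]} -> Prop) :
  (forall x y, Q x -> Q y -> Q (x + y)) -> (forall x y, Q x -> Q y -> Q (x * y)) ->
  (forall c, Q (malgC c)) -> (forall x, Q (mkmalgU (fmu x) 1)) -> forall g, Q g.
Proof.
move=> QD QM QC QX; apply: malg_ind => [|//|[w] c].
  by have := QC 0; rewrite malgC0E.
elim: w c => [|x w IH] c.
  by have := QC c; rewrite /one /= fmoneE.
have -> : mkmalgU (FMonom (x :: w)) c = mkmalgU (fmu x) 1 * mkmalgU (FMonom w) c.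
  by rewrite malgM_def fgmulUU mul1r /mul /= fmmulE fmuE.
exact: QM.
Qed.

Section TensorInduction.
Variables (A B : pzRingType) (f : {rmorphism B -> A}) (M : lmodType B).

Lemma tprod_ind (Q : tprod f M -> Prop) :
  (forall x y, Q x -> Q y -> Q (x - y)) -> (forall a x, Q (tens f a x)) -> forall z, Q z.
Proof.
move=> QB QT z; have Q0 : Q 0 by rewrite -(subrr (tens f 0 (0 : M))); apply: QB.
have QN y : Q y -> Q (- y) by rewrite -sub0r; apply: QB.
have QD x y : Q x -> Q y -> Q (x + y) by move=> Qx /QN; rewrite -{2}[y]opprK; apply: QB.
rewrite -[z]tprod_piK; move: (repr z); apply: malg_ind => [|x y Qx Qy|[a x] k].
- by rewrite raddf0.
- by rewrite raddfD; apply: QD.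
have QU n : Q (tprod_pi f ((mkmalgU (a, x) 1 : {malg int[(A * M)%type]}) *~ Posz n)).
  rewrite -pmulrn raddfMn /=; elim: n => [|n IH]; first by rewrite mulr0n.
  by rewrite mulrS; apply: QD => //; have := QT a x; rewrite /tens -lock.
have -> : mkmalgU (a, x) k = mkmalgU (a, x) (1 : int) *~ k.
  by rewrite -(raddfMz (mkmalgU (a, x))) /= intz.
case: k => n //; rewrite NegzE mulrNz raddfN; by apply: QN; apply: QU.
Qed.

Variables (V : zmodType) (g : A -> M -> V).
Hypothesis gDl : forall a a' x, g (a + a') x = g a x + g a' x.
Hypothesis gDr : forall a x x', g a (x + x') = g a x + g a x'.
Hypothesis g_balanced : forall a b x, g (a * f b) x = g a (b *: x).

(** The universal property of the tensor product, as an existence statement so that the choice of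
    representatives stays hidden. *)
Lemma tprod_lift_exists : exists h : tprod f M -> V,
  zmod_morphism h /\ forall a x, h (tens f a x) = g a x.
Proof.
pose h0 : {additive {malg int[(A * M)%type]} -> V} :=
  malg_ext (fun k : A * M => (intmul (g k.1 k.2) : {additive int -> V})).
have h0E a x : h0 (mkmalgU (a, x) 1) = g a x by rewrite /h0 /= malg_extU.
have h0rel z : z \in zspan (@tprod_rel A B f M) -> h0 z = 0.
  move/zspanP; elim=> [_ [a a' x|a x x'|a b x]||u w _ u0 _ w0].
  - by rewrite raddfB raddfD !h0E gDl subrr.
  - by rewrite raddfB raddfD !h0E gDr subrr.
  - by rewrite raddfB !h0E g_balanced subrr.
  - exact: raddf0.
  - by rewrite raddfB u0 w0 subrr.
have h0pi u w : tprod_pi f u = tprod_pi f w -> h0 u = h0 w.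
  move/eqP; rewrite tprod_piE => /h0rel; rewrite raddfB => /eqP.
  by rewrite subr_eq0 => /eqP.
exists (fun z => h0 (repr z)); split=> [x y|a x].
  by rewrite -(raddfB h0); apply: h0pi; rewrite raddfB /= !tprod_piK.
by rewrite -h0E; apply: h0pi; rewrite tprod_piK /tens -lock.
Qed.
End TensorInduction.

Section EnvelopingInduction.
Variables (F : fieldType) (m n : nat) (W : {vspace 'M[F]_(m + n)}) (p : nat)
  (chi : {scalar subvs_of (@gl0 F m n)}).

Lemma uenv_ind (Q : uenv W p chi -> Prop) :
  (forall x y, Q x -> Q y -> Q (x + y)) -> (forall x y, Q x -> Q y -> Q (x * y)) ->
  (forall c, Q (uenv_scalar W p chi c)) ->
  (forall x, x \in W -> Q (uenv_in W p chi x)) -> forall a, Q a.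
Proof.
(* Three representatives, because [uenv] is a threefold quotient of a free algebra: by linearity, by
   the brackets, and by the $p$-mapping. *)
move=> QD QM QC QX a; rewrite -[a]quotr_piK -[repr a]quotr_piK -[repr (repr a)]quotr_piK.
move: (repr (repr (repr a))); apply: free_algebra_ind => [x y|x y|c|x].
- by rewrite !raddfD; apply: QD.
- by rewrite !rmorphM; apply: QM.
- exact: QC.
- have := QX (vsval x) (subvsP x); rewrite /uenv_in /env_in /tens_mx vsvalK /tens_in.
  by rewrite /tens_gen -lock.
Qed.
End EnvelopingInduction.

(** * The oscillator action of gl(m|n) *)

Section Oscillator.
Variables (F : fieldType) (m n p : nat) (chi : {scalar subvs_of (@gl0 F m n)}).
Hypotheses (charF : p \in [pchar F]) (two_neq0 : (2%:R : F) != 0).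
Local Notation gl_mx := 'M[F]_(m + n).
Local Notation I := ('I_(m + n) * 'I_(m + n))%type.
Local Notation A := (uenv (@gl0 F m n) p chi).
Variable fs : seq I.
Hypotheses (fs_uniq : uniq fs) (fsE : fs =i @in_glm1 m n).
Variable K : fock A fs.
Local Notation B := (fk_ring K).
Local Notation xi := (fk_cr K).
Local Notation dd := (fk_an K).
Local Notation P := (vacuum K fs).
Local Notation u_ a := (@mx_unit F m n a).
Implicit Types (x y z : gl_mx) (e : bool) (a b : I) (c : F).

Definition osc_scalar : F -> B := fk_in K \o uenv_scalar gl0 p chi.
HB.instance Definition _ := GRing.RMorphism.on osc_scalar.
Local Notation eta := osc_scalar.

Lemma osc_scalarC c w : GRing.comm (eta c) w.
Proof. by apply: fk_center => v; apply: uenv_scalarC. Qed.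

(** [B] is only a ring, so linearity over [F] is expressed through the central morphism
    [osc_scalar]. *)
Definition etalinear (g : gl_mx -> B) : Prop :=
  forall c x y, g (c *: x + y) = eta c * g x + g y.

Lemma etalinear0 g : etalinear g -> g 0 = 0.
Proof.
by move=> gL; apply: (addrI (g 0)); rewrite addr0 -{1}[g 0]mul1r -(rmorph1 eta) -gL scale1r addr0.
Qed.

Lemma etalinearD g x y : etalinear g -> g (x + y) = g x + g y.
Proof. by move=> gL; rewrite -[x]scale1r gL rmorph1 mul1r scale1r. Qed.

Lemma etalinear_sg g e x : etalinear g -> g ((-1) ^+ e * x) = (-1) ^+ e * g x.
Proof.
move=> gL; case: e; rewrite ?expr0 ?mul1r // expr1 !mulN1r.
by apply: (addrI (g x)); rewrite -etalinearD // !subrr etalinear0.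
Qed.

Lemma etalinearB g x y : etalinear g -> g (x - y) = g x - g y.
Proof.
by move=> gL; have := @etalinear_sg g true y gL; rewrite !expr1 !mulN1r etalinearD // => ->.
Qed.

Lemma etalinear_scomC g e x y : etalinear g ->
  scom e (g y) (g x) = g (scom e y x) -> scom e (g x) (g y) = g (scom e x y).
Proof.
move=> gL yx; rewrite (scomC e (g y)) yx (scomC e y) -etalinear_sg //.
by apply: (addrI (g ((-1) ^+ e * scom e y x))); rewrite -etalinearD // !subrr etalinear0.
Qed.

Lemma etalinear_sum g (J : Type) (l : seq J) (f : J -> F) (y : J -> gl_mx) :
  etalinear g -> g (\sum_(a <- l) f a *: y a) = \sum_(a <- l) eta (f a) * g (y a).
Proof.
move=> gL; elim: l => [|a l IH]; first by rewrite !big_nil etalinear0.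
by rewrite !big_cons gL IH.
Qed.

Lemma etalinear_comp g (f : gl_mx -> gl_mx) :
  (forall c x y, f (c *: x + y) = c *: f x + f y) -> etalinear g -> etalinear (g \o f).
Proof. by move=> fL gL c x y; rewrite /= fL gL. Qed.

Lemma etalinear_mulr g w : etalinear g -> etalinear (fun x => g x * w).
Proof. by move=> gL c x y; rewrite gL mulrDl mulrA. Qed.

Lemma etalinear_mull g w : etalinear g -> etalinear (fun x => w * g x).
Proof. by move=> gL c x y; rewrite gL mulrDr !mulrA (osc_scalarC c w). Qed.

Lemma etalinear_add g g' : etalinear g -> etalinear g' -> etalinear (fun x => g x + g' x).
Proof. by move=> gL gL' c x y; rewrite gL gL' mulrDr addrACA. Qed.

Lemma etalinear_sumf (J : Type) (l : seq J) (g : J -> gl_mx -> B) :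
  (forall k, etalinear (g k)) -> etalinear (fun x => \sum_(k <- l) g k x).
Proof.
move=> gL c x y; rewrite mulr_sumr -big_split; apply: eq_bigr => k _; exact: gL.
Qed.

Lemma etalinear_scom g e w : etalinear g -> etalinear (fun x => scom e w (g x)).
Proof.
move=> gL c x y; rewrite /scom gL mulrDr mulrDl mulrDr opprD addrACA mulrBr.
congr (_ - _ + _); first by rewrite !mulrA (osc_scalarC c w).
by rewrite !mulrA; congr (_ * _ * _); rewrite (osc_scalarC c).
Qed.

Lemma mem_fs a : a \in fs -> in_glm1 a.
Proof. by rewrite fsE. Qed.

Lemma unit_glm1 a : a \in fs -> u_ a \in glm1.
Proof. by move=> /mem_fs; apply: mx_unit_span. Qed.

Lemma etalinear_ext g g' y : etalinear g -> etalinear g' ->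
  (forall a, a \in fs -> g (u_ a) = g' (u_ a)) -> y \in glm1 -> g y = g' y.
Proof.
move=> gL gL' gg' /(span_units_expand fs_uniq fsE) ->; rewrite !etalinear_sum //.
by apply: eq_big_seq => a afs; rewrite gg'.
Qed.

(* The action of [gl(m|n)] on the induced module, written with creation and
   annihilation operators: [glm1] creates, [x] in [gl0] acts on the coefficients
   by [osc_r x] and on the created vectors by commutators, and for [x] in [gl1]
   the double sum corrects [\sum_a osc_0 [x, u_a] dd_a], in which each pair of
   created vectors is met twice. *)
Definition osc_r x : B := fk_in K (uenv_in gl0 p chi x).
Definition osc_m1 y : B := \sum_(a <- fs) eta (y a.1 a.2) * xi a.
Definition osc_0 x : B := osc_r x + \sum_(a <- fs) osc_m1 (scom false x (u_ a)) * dd a.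
Definition osc_1 x : B :=
  \sum_(a <- fs) osc_r (scom true x (u_ a)) * dd a
  + eta 2^-1 * \sum_(a <- fs) \sum_(b <- fs)
      osc_m1 (scom false (scom true x (u_ a)) (u_ b)) * dd b * dd a.
(** [osc_m1] reads only the entries indexed by [fs], so it can be applied to [x] itself; the other
    two need a projection. *)
Definition osc x : B := osc_m1 x + osc_0 (diag_part x) + osc_1 (up_part x).

Lemma osc_rL : etalinear osc_r.
Proof. by move=> c x y; rewrite /osc_r uenv_in_linear rmorphD rmorphM. Qed.
Lemma osc_m1L : etalinear osc_m1.
Proof.
apply: etalinear_sumf => a c x y; rewrite !mxE rmorphD rmorphM mulrDl -mulrA //.
Qed.
Lemma osc_0L : etalinear osc_0.
Proof.
apply: etalinear_add osc_rL _; apply: etalinear_sumf => a; apply: etalinear_mulr.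
by apply: etalinear_comp osc_m1L => c x y; apply: scom_linearl.
Qed.
Lemma osc_1L : etalinear osc_1.
Proof.
apply: etalinear_add; [|apply: etalinear_mull]; apply: etalinear_sumf => a.
  by apply: etalinear_mulr; apply: etalinear_comp osc_rL => c x y; apply: scom_linearl.
apply: etalinear_sumf => b; do 2!apply: etalinear_mulr.
by apply: etalinear_comp osc_m1L => c x y; rewrite !scom_linearl.
Qed.
Lemma oscL : etalinear osc.
Proof.
apply: etalinear_add; [apply: etalinear_add osc_m1L _|];
  by [apply: etalinear_comp osc_0L => c x y; rewrite linearP
     |apply: etalinear_comp osc_1L => c x y; rewrite linearP].
Qed.

Lemma osc_m1_eq0 Q x : x \in span_units F Q -> (forall a, Q a -> ~~ in_glm1 a) ->
  osc_m1 x = 0.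
Proof.
move=> /span_unitsP xP QQ; rewrite /osc_m1 big_seq big1 // => -[i j] /mem_fs ij.
by rewrite xP ?rmorph0 ?mul0r //; apply: contraL ij; apply: QQ.
Qed.

Lemma oscm1E x : x \in glm1 -> osc x = osc_m1 x.
Proof.
move=> xP; rewrite /osc (diag_part_eq0 xP) ?(up_part_eq0 xP).
- by rewrite (etalinear0 osc_0L) (etalinear0 osc_1L) !addr0.
- by move=> a; rewrite /in_glm1 /in_gl1; case: (low _); case: (low _).
- by move=> a; rewrite /in_glm1 /in_gl0; case: (low _); case: (low _).
Qed.
Lemma osc0E x : x \in gl0 -> osc x = osc_0 x.
Proof.
move=> xP; rewrite /osc (osc_m1_eq0 xP) ?(up_part_eq0 xP) ?diag_part_id //.
- by rewrite (etalinear0 osc_1L) addr0 add0r.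
- by move=> a; rewrite /in_gl0 /in_gl1; case: (low _); case: (low _).
- by move=> a; rewrite /in_glm1 /in_gl0; case: (low _); case: (low _).
Qed.
Lemma osc1E x : x \in gl1 -> osc x = osc_1 x.
Proof.
move=> xP; rewrite /osc (osc_m1_eq0 xP) ?(diag_part_eq0 xP) ?up_part_id //.
- by rewrite (etalinear0 osc_0L) !add0r.
- by move=> a; rewrite /in_gl0 /in_gl1; case: (low _); case: (low _).
- by move=> a; rewrite /in_glm1 /in_gl1; case: (low _); case: (low _).
Qed.

Lemma osc_m1_unit b : b \in fs -> osc_m1 (u_ b) = xi b.
Proof.
move=> bfs; rewrite /osc_m1 (bigD1_seq b) //= big1 => [|a nab].
  by rewrite mxE !eqxx rmorph1 mul1r addr0.
rewrite mxE; case: eqP => [a1|]; case: eqP => [a2|]; rewrite ?rmorph0 ?mul0r //.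
by case/eqP: nab; rewrite [a]surjective_pairing a1 a2 -surjective_pairing.
Qed.

Lemma osc_unit b : b \in fs -> osc (u_ b) = xi b.
Proof. by move=> bfs; rewrite oscm1E ?unit_glm1 ?osc_m1_unit. Qed.

Lemma osc_m1_xi x b : b \in fs -> osc_m1 x * xi b = - (xi b * osc_m1 x).
Proof.
move=> bfs; rewrite /osc_m1 mulr_suml mulr_sumr -sumrN; apply: eq_big_seq => a afs.
by rewrite -mulrA (fk_crcr K afs bfs) mulrN !mulrA osc_scalarC.
Qed.

Lemma osc_m1_anticomm (w : B) y : (forall b, b \in fs -> w * xi b = - (xi b * w)) ->
  w * osc_m1 y + osc_m1 y * w = 0.
Proof.
move=> wC; apply/eqP; rewrite addr_eq0; apply/eqP; rewrite /osc_m1 mulr_suml mulr_sumr -sumrN.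
apply: eq_big_seq => b bfs.
by rewrite mulrA -osc_scalarC -mulrA wC // mulrN mulrA.
Qed.

Lemma sum_delta (g : I -> B) b : b \in fs -> \sum_(a <- fs) g a * (a == b)%:R = g b.
Proof.
move=> bfs; rewrite (bigD1_seq b) //= eqxx mulr1 big1 ?addr0 // => a /negPf ->.
by rewrite mulr0.
Qed.

Lemma scom_osc_0_xi x b : x \in gl0 -> b \in fs ->
  scom false (osc_0 x) (xi b) = osc_m1 (scom false x (u_ b)).
Proof.
move=> x0 bfs; rewrite /scom mul1r /osc_0 mulrDl mulrDr fk_crC opprD addrACA subrr add0r.
rewrite mulr_suml mulr_sumr -sumrB -(sum_delta (fun a => osc_m1 (scom false x (u_ a))) bfs).
apply: eq_big_seq => a afs; rewrite -mulrA fk_ancr // mulrBr [xi b * (_ * _)]mulrA.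
by rewrite [osc_m1 _ * (_ * _)]mulrA osc_m1_xi // mulNr opprK addrK.
Qed.

(** Jacobi together with $[u_a,u_b]=0$. It makes the coefficients of the double sum in [osc_1]
    antisymmetric. *)
Lemma scom_1NN x a b : x \in gl1 -> a \in fs -> b \in fs ->
  scom false (scom true x (u_ b)) (u_ a) = - scom false (scom true x (u_ a)) (u_ b).
Proof.
move=> x1 afs bfs.
have := scom_jacobi true true true x (u_ a) (u_ b); rewrite /= expr1 => ->.
rewrite (scomNN _ (unit_glm1 afs) (unit_glm1 bfs)) mulN1r opprK.
by rewrite (scomC false _ (u_ a)) expr0 mul1r /scom mulr0 mul0r !mulr0 subr0 add0r opprK.
Qed.

Lemma scom_osc_1_xi x b : x \in gl1 -> b \in fs ->
  scom true (osc_1 x) (xi b) = osc_0 (scom true x (u_ b)).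
Proof.
move=> x1 bfs; rewrite scom_trueE /osc_1 mulrDl mulrDr addrACA; congr (_ + _).
  rewrite mulr_suml mulr_sumr -big_split -(sum_delta (fun a => osc_r (scom true x (u_ a))) bfs).
  apply: eq_big_seq => a afs /=.
  by rewrite -mulrA fk_ancr // mulrBr [xi b * (_ * _)]mulrA -fk_crC -!mulrA subrK.
rewrite (mulrA (xi b)) -osc_scalarC -!mulrA -mulrDr.
pose g a k := osc_m1 (scom false (scom true x (u_ a)) (u_ k)).
have gC a k : a \in fs -> k \in fs -> g a k = - g k a.
  move=> afs kfs; rewrite /g scom_1NN //.
  by have := etalinear_sg true (scom false (scom true x (u_ k)) (u_ a)) osc_m1L; rewrite !expr1 !mulN1r.
have gxi a k : g a k * xi b = - (xi b * g a k) by rewrite /g osc_m1_xi.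
rewrite -[RHS]/(\sum_(a <- fs) g b a * dd a).
rewrite -[X in X * xi b + _]/(\sum_(a <- fs) \sum_(k <- fs) g a k * dd k * dd a).
rewrite -[X in _ + xi b * X]/(\sum_(a <- fs) \sum_(k <- fs) g a k * dd k * dd a).
move: g gC gxi => g gC gxi.
(* Moving $\xi_b$ from the right end of a summand to the left end contracts it once with each
   annihilator; the uncontracted terms cancel. *)
have main a k : a \in fs -> k \in fs ->
    g a k * dd k * dd a * xi b + xi b * (g a k * dd k * dd a)
    = g a k * dd k * (a == b)%:R - g a k * (k == b)%:R * dd a.
  move=> afs kfs; rewrite -(mulrA _ (dd a)) fk_ancr // mulrBr -addrA; congr (_ + _).
  rewrite !mulrA -(mulrA _ (dd k)) fk_ancr // mulrBr mulrBl opprB mulrA.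
  by rewrite gxi !mulNr addrAC addNr sub0r.
have -> : (\sum_(a <- fs) \sum_(k <- fs) g a k * dd k * dd a) * xi b
   + xi b * (\sum_(a <- fs) \sum_(k <- fs) g a k * dd k * dd a)
   = \sum_(k <- fs) g b k * dd k - \sum_(a <- fs) g a b * dd a.
  transitivity (\sum_(a <- fs) \sum_(k <- fs)
      (g a k * dd k * (a == b)%:R - g a k * (k == b)%:R * dd a)).
    rewrite mulr_suml mulr_sumr -big_split; apply: eq_big_seq => a afs /=.
    rewrite mulr_suml mulr_sumr -big_split; apply: eq_big_seq => k kfs /=.
    exact: main.
  transitivity (\sum_(a <- fs) ((\sum_(k <- fs) g a k * dd k) * (a == b)%:R
      - (\sum_(k <- fs) g a k * (k == b)%:R) * dd a)).
    by apply: eq_bigr => a _; rewrite sumrB -!mulr_suml.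
  rewrite sumrB; congr (_ - _).
    exact: (sum_delta (fun a => \sum_(k <- fs) g a k * dd k) bfs).
  by apply: eq_bigr => a _; congr (_ * _); exact: (sum_delta (g a) bfs).
(* Antisymmetry of [g] turns the difference into twice the wanted sum, which is where the factor
   $1/2$ in [osc_1] comes from. *)
have -> : \sum_(a <- fs) g a b * dd a = - \sum_(a <- fs) g b a * dd a.
  by rewrite -sumrN; apply: eq_big_seq => a afs; rewrite gC // mulNr.
rewrite opprK -[X in X + X]mul1r -mulrDl mulrA -(rmorph1 eta) -rmorphD -rmorphM.
by rewrite -[1 + 1]/(2%:R) mulVf // rmorph1 mul1r.
Qed.

(** Unlike in [gl_parity], the odd piece leaves out [glm1]: on what remains, the action on the
    vacuum has the closed form of [osc_vacuum]. *)
Definition glp (s : bool) : {vspace gl_mx} := if s then gl1 else gl0.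

Lemma scom_osc_glm1 s x y : x \in glp s -> y \in glm1 ->
  scom s (osc x) (osc y) = osc (scom s x y).
Proof.
move=> xs; apply: (etalinear_ext (etalinear_scom _ _ oscL)
  (etalinear_comp (scom_linearr _ _) oscL)) => b bfs /=.
have bN := unit_glm1 bfs; rewrite osc_unit //; case: s xs => xs.
  by rewrite osc1E // osc0E ?scom1N // scom_osc_1_xi.
by rewrite osc0E // oscm1E ?scom0N // scom_osc_0_xi.
Qed.

Lemma osc_vacuum s x : x \in glp s -> osc x * P = (if s then 0 else osc_r x) * P.
Proof.
have an_P a : a \in fs -> dd a * P = 0 by exact: an_vacuum.
case: s => xs /=.
  rewrite osc1E // /osc_1 mulrDl -mulrA !mulr_suml big_seq big1 => [|a afs].
    rewrite add0r [X in _ * X]big_seq [X in _ * X]big1 ?mulr0 ?mul0r // => a afs.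
    by rewrite mulr_suml big1 // => b _; rewrite -mulrA an_P ?mulr0.
  by rewrite -mulrA an_P ?mulr0.
rewrite osc0E // /osc_0 mulrDl mulr_suml big_seq big1 ?addr0 // => a afs.
by rewrite -mulrA an_P ?mulr0.
Qed.

Lemma osc_r_vacuum x : osc_r x * P = P * osc_r x.
Proof. by rewrite /osc_r fk_in_vacuum. Qed.

Lemma osc_r_bracket x y : x \in gl0 -> y \in gl0 ->
  scom false (osc_r x) (osc_r y) = osc_r (scom false x y).
Proof.
move=> x0 y0; have := @uenv_in_bracket F m n gl0 p chi false false x y x0 y0 x0 y0.
rewrite sbracketE /osc_r /= => <-.
by rewrite /scom rmorphB !rmorphM rmorph1.
Qed.

Lemma osc_r_pmap (x : subvs_of (@gl0 F m n)) :
  osc_r (vsval x) ^+ p - osc_r (vsval x ^+ p) = eta (chi x ^+ p).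
Proof. by rewrite /osc_r -rmorphXn -rmorphB uenv_in_pmap. Qed.

(** Degree 2 is absent from the algebra, hence the vanishing when both elements are odd; in the
    other cases degrees add up like parities. *)
Lemma scom_glp s t x y : x \in glp s -> y \in glp t ->
  if s && t then scom true x y = 0 else scom (s && t) x y \in glp (s (+) t).
Proof.
case: s t => [] [] /= xs yt; [exact: scom11|exact: scom10|exact: scom01|exact: scom00].
Qed.

(* All relations follow from [vacuum_eq0]: the defect of each one kills the vacuum
   and, by the Jacobi identity, commutes with creation operators. *)
Section Relations.
Variables h r : gl_mx -> B.
Hypothesis hL : etalinear h.
Hypothesis h_unit : forall b, b \in fs -> h (u_ b) = xi b.
Hypothesis h_glm1 : forall s x y, x \in glp s -> y \in glm1 ->
  scom s (h x) (h y) = h (scom s x y).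
Hypothesis h_vacuum : forall s x, x \in glp s -> h x * P = (if s then 0 else r x) * P.
Hypothesis r_vacuum : forall x, r x * P = P * r x.
Hypothesis r_bracket : forall x y, x \in gl0 -> y \in gl0 ->
  scom false (r x) (r y) = r (scom false x y).
Hypothesis r_pmap : forall x : subvs_of (@gl0 F m n),
  r (vsval x) ^+ p - r (vsval x ^+ p) = eta (chi x ^+ p).

Lemma h_mul_vacuum s t x y : x \in glp s -> y \in glp t ->
  h x * h y * P = P * ((if s then 0 else r x) * (if t then 0 else r y)).
Proof.
have top_vac e z : (if e then 0 else r z) * P = P * (if e then 0 else r z).
  by case: e; rewrite ?mul0r ?mulr0.
move=> xs yt; rewrite -mulrA (h_vacuum yt) top_vac mulrA (h_vacuum xs).
by rewrite top_vac mulrA.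
Qed.

Lemma h_scom_vacuum s t x y : x \in glp s -> y \in glp t ->
  scom (s && t) (h x) (h y) * P = h (scom (s && t) x y) * P.
Proof.
move=> xs yt; rewrite {1}/scom mulrBl -(mulrA ((-1) ^+ _)).
rewrite (h_mul_vacuum xs yt) (h_mul_vacuum yt xs).
have := scom_glp xs yt; case: s t xs yt => [] [] xs yt /=.
- by move=> ->; rewrite (etalinear0 hL) !(mul0r, mulr0) subr0.
- by move/(@h_vacuum true) => ->; rewrite !(mul0r, mulr0) subr0.
- by move/(@h_vacuum true) => ->; rewrite !(mul0r, mulr0) subr0.
- move/(@h_vacuum false) => ->; rewrite r_vacuum /= -r_bracket //.
  by rewrite /scom !mul1r mulrBr.
Qed.

(** By Jacobi, the commutator of the defect with $\xi_b$ is made of the defects for the pairs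
    $x,[y,u_b]$ and $y,[x,u_b]$, whose total degree is one lower. *)
Lemma h_bracket_step s t x y : x \in glp s -> y \in glp t ->
  (forall b, b \in fs -> scom (s && ~~ t) (h x) (h (scom t y (u_ b)))
     = h (scom (s && ~~ t) x (scom t y (u_ b)))) ->
  (forall b, b \in fs -> scom (t && ~~ s) (h y) (h (scom s x (u_ b)))
     = h (scom (t && ~~ s) y (scom s x (u_ b)))) ->
  scom (s && t) (h x) (h y) = h (scom (s && t) x y).
Proof.
move=> xs yt xyb yxb; apply/eqP; rewrite -subr_eq0; apply/eqP.
apply: (@vacuum_eq0 _ _ _ K (s (+) t) _ fs) => // [b bfs|]; last first.
  by rewrite mulrBl h_scom_vacuum // subrr.
have bN := unit_glm1 bfs; apply/eqP; rewrite -subr_eq0 -/(scom _ _ _) scomBl.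
have := scom_jacobi s t true (h x) (h y) (xi b).
rewrite !andbT !addbT => ->; rewrite -(h_unit bfs).
rewrite (h_glm1 xs bN) (h_glm1 yt bN) xyb // yxb //.
have -> : scom (s (+) t) (h (scom (s && t) x y)) (h (u_ b))
    = h (scom (s (+) t) (scom (s && t) x y) (u_ b)).
  have := scom_glp xs yt; case: (s && t) (s (+) t) => e => [->|xy].
    by rewrite (etalinear0 hL) /scom !(mul0r, mulr0, subr0) (etalinear0 hL).
  exact: h_glm1.
have := scom_jacobi s t true x y (u_ b); rewrite !andbT !addbT => ->.
by rewrite (etalinearB (scom _ _ _) _ hL) (etalinear_sg _ _ hL) subrr.
Qed.

Lemma h_bracket_glp s t x y : x \in glp s -> y \in glp t ->
  scom (s && t) (h x) (h y) = h (scom (s && t) x y).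
Proof.
(* Induction on the total degree: degrees (0,0) rest on [h_glm1], (1,0) on (0,0), and (1,1) on
   (1,0); (0,1) is (1,0) with the order exchanged. *)
have b00 x' y' : x' \in gl0 -> y' \in gl0 ->
    scom false (h x') (h y') = h (scom false x' y').
  move=> x0 y0; apply: (@h_bracket_step false false) => // b bfs /=;
  by rewrite (@h_glm1 false) ?scom0N ?unit_glm1.
have b10 x' y' : x' \in gl1 -> y' \in gl0 ->
    scom false (h x') (h y') = h (scom false x' y').
  move=> x0 y0; apply: (@h_bracket_step true false) => // b bfs /=.
    by rewrite (@h_glm1 true) ?scom0N ?unit_glm1.
  by rewrite b00 ?scom1N ?unit_glm1.
case: s t => [] [] xs yt; [|exact: b10| |exact: b00].
- by apply: (@h_bracket_step true true) => // b bfs /=; rewrite b10 ?scom1N ?unit_glm1.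
- by apply: etalinear_scomC => //; apply: b10.
Qed.

Hypothesis h_NN : forall x y, x \in glm1 -> y \in glm1 -> scom true (h x) (h y) = 0.

Lemma h_bracketDl e x x' y : scom e (h x) (h y) = h (scom e x y) ->
  scom e (h x') (h y) = h (scom e x' y) ->
  scom e (h (x + x')) (h y) = h (scom e (x + x') y).
Proof. by move=> xy x'y; rewrite (etalinearD x x' hL) !scomDl xy x'y -etalinearD. Qed.

Lemma h_bracketDr e x y y' : scom e (h x) (h y) = h (scom e x y) ->
  scom e (h x) (h y') = h (scom e x y') ->
  scom e (h x) (h (y + y')) = h (scom e x (y + y')).
Proof.
by move=> xy xy'; apply: etalinear_scomC => //; apply: h_bracketDl; apply: etalinear_scomC.
Qed.

Lemma h_bracket s t x y : x \in gl_parity s -> y \in gl_parity t ->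
  scom (s && t) (h x) (h y) = h (scom (s && t) x y).
Proof.
case: s t => [] [] xs yt.
- case/memv_addP: xs => [x1 x1N [x2 x2P ->]]; case/memv_addP: yt => [y1 y1N [y2 y2P ->]].
  apply: h_bracketDl; apply: h_bracketDr.
  + by rewrite h_NN // scomNN // (etalinear0 hL).
  + by apply: etalinear_scomC => //; apply: (@h_glm1 true).
  + exact: (@h_glm1 true).
  + exact: (@h_bracket_glp true true).
- case/memv_addP: xs => [x1 x1N [x2 x2P ->]]; apply: h_bracketDl.
    by apply: etalinear_scomC => //; apply: (@h_glm1 false).
  exact: (@h_bracket_glp true false).
- case/memv_addP: yt => [y1 y1N [y2 y2P ->]]; apply: h_bracketDr.
    exact: (@h_glm1 false).
  exact: (@h_bracket_glp false true).
- exact: (@h_bracket_glp false false).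
Qed.

(** In characteristic $p$, commuting with $h(x)^p$ and bracketing with $x^p$ are both $p$-fold
    brackets, so the defect commutes with creation operators. On the vacuum it is the relation
    [r_pmap]. *)
Lemma h_pmap (x : subvs_of (@gl0 F m n)) :
  h (vsval x) ^+ p - h (vsval x ^+ p) = eta (chi x ^+ p).
Proof.
have x0 : vsval x \in gl0 by apply: subvsP.
have xp0 : vsval x ^+ p \in gl0 by apply: gl0X.
have pp : prime p by case/andP: charF.
have torsB (w : B) : w *+ p = 0.
  by rewrite -mulr_natl -(rmorph_nat eta) (pcharf0 charF) rmorph0 mul0r.
have torsM (w : gl_mx) : w *+ p = 0 by apply: pchar_mulrn_mx.
apply/eqP; rewrite -subr_eq0; apply/eqP.
apply: (@vacuum_eq0 _ _ _ K false _ fs) => // [b bfs|].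
  have bN := unit_glm1 bfs; apply/eqP; rewrite -subr_eq0 -/(scom _ _ _) !scomBl.
  rewrite ad_exprp // -(h_unit bfs) (@h_glm1 false) // ad_exprp //.
  have -> : scom false (eta (chi x ^+ p)) (h (u_ b)) = 0.
    by rewrite /scom expr0 mul1r osc_scalarC subrr.
  rewrite subr0 subr_eq0; apply/eqP.
  have iterP k : iter k (scom false (vsval x)) (u_ b) \in glm1 /\
      iter k (scom false (h (vsval x))) (h (u_ b)) = h (iter k (scom false (vsval x)) (u_ b)).
    elim: k => [|k [IHm IH]] //=; split; first exact: scom0N.
    by rewrite IH (@h_glm1 false).
  by case: (iterP p).
have powP k : h (vsval x) ^+ k * P = r (vsval x) ^+ k * P.
  elim: k => [|k IH] //; rewrite exprSr -mulrA (@h_vacuum false _ x0) r_vacuum mulrA IH.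
  by rewrite -mulrA -r_vacuum mulrA -exprSr.
by rewrite !mulrBl (@h_vacuum false _ xp0) -r_pmap mulrBl opprB addrA subrK powP subrr.
Qed.
End Relations.

Lemma osc_NN x y : x \in glm1 -> y \in glm1 -> scom true (osc x) (osc y) = 0.
Proof.
move=> xN yN; rewrite scom_trueE (oscm1E xN) (oscm1E yN).
by apply: osc_m1_anticomm => k; apply: osc_m1_xi.
Qed.

Lemma osc_map : uenv_map gl p chi osc_scalar osc.
Proof.
split=> [||||s t x y _ _ xs yt|].
- exact: osc_scalarC.
- exact: oscL.
- by apply/subvP => x _; apply: mem_gl.
- by move=> *; apply: mem_gl.
- rewrite sbracketE.
  exact: (h_bracket oscL osc_unit scom_osc_glm1 osc_vacuum osc_r_vacuum osc_r_bracket osc_NN).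
- exact: (h_pmap osc_unit scom_osc_glm1 osc_vacuum osc_r_vacuum osc_r_pmap).
Qed.

(** * Vacuum expectations and maps out of the baby Verma module *)

Lemma fk_exp_sumr (J : eqType) (l : seq J) (w : B) (g : J -> B) :
  (forall k, k \in l -> fk_exp K (w * g k) = 0) -> fk_exp K (w * \sum_(k <- l) g k) = 0.
Proof. by move=> g0; rewrite mulr_sumr raddf_sum big_seq big1. Qed.

Lemma fk_exp_suml (J : eqType) (l : seq J) (w : B) (g : J -> B) :
  (forall k, k \in l -> fk_exp K (g k * w) = 0) -> fk_exp K ((\sum_(k <- l) g k) * w) = 0.
Proof. by move=> g0; rewrite mulr_suml raddf_sum big_seq big1. Qed.

Lemma fk_exp_osc_0r w x : fk_exp K (w * osc_0 x) = fk_exp K w * uenv_in gl0 p chi x.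
Proof.
rewrite /osc_0 mulrDr raddfD [X in _ + X]fk_exp_sumr => [|a afs].
  by rewrite addr0; apply: fk_expMr.
by rewrite mulrA fk_exp_an.
Qed.

Lemma fk_exp_osc_1r w x : fk_exp K (w * osc_1 x) = 0.
Proof.
rewrite /osc_1 mulrDr raddfD fk_exp_sumr => [|a afs]; last by rewrite mulrA fk_exp_an.
rewrite add0r mulrA fk_exp_sumr // => a afs; apply: fk_exp_sumr => b bfs.
by rewrite mulrA fk_exp_an.
Qed.

Lemma fk_exp_osc_m1l w x : fk_exp K (osc_m1 x * w) = 0.
Proof.
by apply: fk_exp_suml => a afs; rewrite osc_scalarC -mulrA fk_exp_cr.
Qed.

Lemma fk_exp_osc_0l w x : fk_exp K (osc_0 x * w) = uenv_in gl0 p chi x * fk_exp K w.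
Proof.
rewrite /osc_0 mulrDl raddfD [X in _ + X]fk_exp_suml => [|a afs].
  by rewrite addr0; apply: fk_expMl.
by rewrite -mulrA fk_exp_osc_m1l.
Qed.

Definition osc_lift : uenv gl p chi -> B := uenv_lift osc_map.
HB.instance Definition _ := GRing.RMorphism.on osc_lift.

Lemma osc_liftE x : osc_lift (uenv_in gl p chi x) = osc x.
Proof. by apply: uenv_liftE; apply: mem_gl. Qed.

Lemma osc_liftC c : osc_lift (uenv_scalar gl p chi c) = eta c.
Proof. exact: uenv_liftC. Qed.

(** At the right end of an expectation [gl1] vanishes and [gl0] acts through its coefficient. This
    is exactly the inflation along [uenv_proj] used in the baby Verma module, hence the balancedness
    required by [bv_functional]. *)
Lemma fk_exp_incl (b : uenv gl_plus p chi) w :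
  fk_exp K (w * osc_lift (uenv_incl b)) = fk_exp K w * uenv_proj b.
Proof.
move: b w; apply: uenv_ind => [x y IHx IHy w|x y IHx IHy w|c w|x xP w].
- by rewrite !rmorphD !mulrDr raddfD IHx IHy.
- by rewrite !rmorphM !mulrA IHy IHx.
- have -> : uenv_incl (uenv_scalar gl_plus p chi c) = uenv_scalar gl p chi c.
    exact: uenv_liftC.
  have -> : uenv_proj (uenv_scalar gl_plus p chi c) = uenv_scalar gl0 p chi c.
    exact: uenv_liftC.
  by rewrite osc_liftC /osc_scalar /= fk_expMr.
- rewrite (uenv_inclE p chi xP) (uenv_projE p chi xP) osc_liftE /osc.
  have -> : osc_m1 x = 0.
    rewrite /osc_m1 big_seq big1 // => a /mem_fs aN.
    by move/gl_plusP: xP => ->; rewrite ?rmorph0 ?mul0r -?surjective_pairing.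
  by rewrite add0r mulrDr raddfD fk_exp_osc_0r fk_exp_osc_1r addr0.
Qed.

Variable M : lmodType (uenv (@gl0 F m n) p chi).
Local Notation Z := (baby_verma M).

Definition bv_tens (a : uenv gl p chi) (x : M) : Z :=
  tens (@uenv_incl F m n p chi) a (x : restr (@uenv_proj F m n p chi) M).

Lemma bv_tensE (u a : uenv gl p chi) (x : M) : u *: bv_tens a x = bv_tens (u * a) x.
Proof. exact: tprod_scaleE. Qed.

Lemma bv_ind (Q : Z -> Prop) : (forall z z' : Z, Q z -> Q z' -> Q (z - z')) ->
  (forall (a : uenv gl p chi) (x : M), Q (bv_tens a x)) -> forall z : Z, Q z.
Proof. exact: tprod_ind. Qed.

(* Balanced over [u(gl_plus, chi)] because the vacuum is killed by [gl1]. *)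
Lemma bv_functional (w : B) : exists pr : Z -> M,
  zmod_morphism pr /\
  forall (a : uenv gl p chi) (x : M), pr (bv_tens a x) = fk_exp K (w * osc_lift a) *: x.
Proof.
apply: tprod_lift_exists => [a a' x|a x x'|a b x].
- by rewrite rmorphD mulrDr raddfD scalerDl.
- by rewrite scalerDr.
- by rewrite rmorphM mulrA fk_exp_incl restr_scaleE scalerA.
Qed.

(** The functional with [w] equal to 1. The expectation kills creation operators at its left end,
    which disposes of [glm1] and reduces [gl0] to its action on coefficients. *)
Lemma bv_vacuum_coef : exists pr : Z -> M,
  [/\ zmod_morphism pr, forall x : M, pr (bv_in x) = x,
      forall y (z : Z), y \in glm1 -> pr (uenv_in gl p chi y *: z) = 0,
      forall x (z : Z), x \in gl0 -> pr (uenv_in gl p chi x *: z) = uenv_in gl0 p chi x *: pr z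
    & forall c (z : Z), pr (uenv_scalar gl p chi c *: z) = uenv_scalar gl0 p chi c *: pr z].
Proof.
have [pr [prB prE]] := bv_functional 1; exists pr.
have pr_in (x : M) : pr (bv_in x) = x.
  by rewrite prE rmorph1 mulr1 fk_exp1 scale1r.
split=> // [y z yN|x z x0|c z]; elim/bv_ind: z => [u w Hu Hw|a z].
- by rewrite scalerBr prB Hu Hw subrr.
- by rewrite bv_tensE prE mul1r rmorphM /= osc_liftE oscm1E // fk_exp_osc_m1l scale0r.
- by rewrite scalerBr !prB scalerBr Hu Hw.
- by rewrite bv_tensE !prE !mul1r rmorphM /= osc_liftE osc0E // fk_exp_osc_0l scalerA.
- by rewrite scalerBr !prB scalerBr Hu Hw.
- by rewrite bv_tensE !prE !mul1r rmorphM /= osc_liftC /osc_scalar /= fk_expMl scalerA.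
Qed.

(** The annihilators come in reverse order so that each one is adjacent to its own creation operator
    when its turn comes. *)
Lemma fk_exp_an_cr (t : seq I) : uniq t -> {subset t <= fs} ->
  fk_exp K (\prod_(a <- rev t) dd a * \prod_(a <- t) xi a) = 1.
Proof.
elim: t => [|a t IH] /=; first by rewrite !big_nil mulr1 fk_exp1.
move=> /andP [nat ut] ts; have afs : a \in fs by rewrite ts ?mem_head.
have tfs : {subset t <= fs} by move=> b bt; rewrite ts // inE bt orbT.
rewrite rev_cons -cats1 big_cat big_seq1 big_cons /= -mulrA (mulrA (dd a)) fk_ancr // eqxx.
rewrite mulrBl mul1r mulrBr raddfB IH //.
(* The leftover term of the contraction: since $a$ is not in [t], $\xi_a$ anticommutes past the
   other annihilators to the far left, where the expectation kills it. *)
have crC : exists w, \prod_(b <- rev t) dd b * xi a = xi a * w.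
  have : {subset rev t <= t} by move=> b; rewrite mem_rev.
  elim: (rev t) => [|b l IHl] lt; first by exists 1; rewrite big_nil mulr1 mul1r.
  have [|w wE] := IHl; first by move=> k kl; rewrite lt // inE kl orbT.
  have bt : b \in t by rewrite lt ?mem_head.
  exists (- (dd b * w)); rewrite big_cons -mulrA wE mulrA fk_ancr ?(tfs _ bt) //.
  case: eqP => [ba|_]; last by rewrite sub0r mulNr mulrN mulrA.
  by move: nat; rewrite -ba bt.
by case: crC => w wE; rewrite !mulrA wE -!mulrA fk_exp_cr // subr0.
Qed.

(** The functional weighted by the product of all annihilators recovers [x] from the top
    component. *)
Lemma bv_top_inj (x : M) :
  (\prod_(a <- fs) uenv_in gl p chi (u_ a)) *: (bv_in x : Z) = 0 -> x = 0.
Proof.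
have [pr [prB prE]] := bv_functional (\prod_(a <- rev fs) dd a).
have topE : osc_lift (\prod_(a <- fs) uenv_in gl p chi (u_ a)) = \prod_(a <- fs) xi a.
  rewrite (rmorph_prod osc_lift); apply: eq_big_seq => a afs.
  by rewrite [LHS]osc_liftE osc_unit.
move=> /(congr1 pr); rewrite -[bv_in x]/(bv_tens 1 x) bv_tensE prE mulr1 topE.
by rewrite fk_exp_an_cr // scale1r => ->; rewrite -(subrr 0) prB subrr.
Qed.
End Oscillator.

(** * Simplicity of graded induced modules *)

Section ZspanClosure.
Variables (V : zmodType) (S : V -> Prop).

Lemma zspan_propN x : zspan_prop S x -> zspan_prop S (- x).
Proof. by move=> Sx; rewrite -sub0r; apply: zspan_B => //; apply: zspan_0. Qed.

Lemma zspan_propD x y : zspan_prop S x -> zspan_prop S y -> zspan_prop S (x + y).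
Proof. by move=> Sx /zspan_propN Sy; rewrite -[y]opprK; apply: zspan_B. Qed.

Lemma zspan_prop_sum (J : eqType) (l : seq J) (g : J -> V) :
  (forall k, k \in l -> zspan_prop S (g k)) -> zspan_prop S (\sum_(k <- l) g k).
Proof.
move=> gS; rewrite big_seq; apply: big_ind => //; [exact: zspan_0|exact: zspan_propD].
Qed.

Lemma zspan_prop_ind (W : zmodType) (T : W -> Prop) (g : V -> W) : zmod_morphism g ->
  T 0 -> (forall x y, T x -> T y -> T (x - y)) -> (forall x, S x -> T (g x)) ->
  forall x, zspan_prop S x -> T (g x).
Proof.
move=> gB T0 TB ST x; elim=> [{}x /ST //||u w _ Tu _ Tw]; last by rewrite gB; apply: TB.
by rewrite -(subrr 0) gB subrr.
Qed.
End ZspanClosure.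

Section GradedInduction.
Variables (F : fieldType) (m n : nat) (U : pzRingType) (iU : 'M[F]_(m + n) -> U)
  (cU : {rmorphism F -> U}) (Z : lmodType U).
Local Notation gl_mx := 'M[F]_(m + n).
Local Notation I := ('I_(m + n) * 'I_(m + n))%type.
Hypothesis two_neq0 : (2%:R : F) != 0.
Hypothesis cUC : forall c a, GRing.comm (cU c) a.
Hypothesis iU_lin : forall c x y, iU (c *: x + y) = cU c * iU x + iU y.
Hypothesis iU_bracket : forall s t x y, x \in gl_parity s -> y \in gl_parity t ->
  scom (s && t) (iU x) (iU y) = iU (scom (s && t) x y).
Implicit Types (x y : gl_mx) (a b : I) (c : F) (z w : Z) (t : seq I).
Local Notation "x ## z" := (iU x *: z) (at level 40).
Local Notation u_ a := (@mx_unit F m n a).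

Lemma iU0 : iU 0 = 0.
Proof.
by apply: (addrI (iU 0)); rewrite addr0 -{1}[iU 0]mul1r -(rmorph1 cU) -iU_lin scale1r addr0.
Qed.

Lemma iU_sum (J : Type) (l : seq J) (c : J -> F) (y : J -> gl_mx) :
  iU (\sum_(k <- l) c k *: y k) = \sum_(k <- l) cU (c k) * iU (y k).
Proof. by elim: l => [|k l IH]; rewrite ?big_nil ?iU0 // !big_cons iU_lin IH. Qed.

Lemma iUD x y : iU (x + y) = iU x + iU y.
Proof. by rewrite -[x]scale1r iU_lin rmorph1 mul1r scale1r. Qed.

Lemma gl1_parity x : x \in gl1 -> x \in gl_parity true.
Proof. exact: (subvP (addvSr _ _)). Qed.
Lemma glm1_parity x : x \in glm1 -> x \in gl_parity true.
Proof. exact: (subvP (addvSl _ _)). Qed.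

Lemma act_even s x y z : x \in gl0 -> y \in gl_parity s ->
  x ## (y ## z) = y ## (x ## z) + scom false x y ## z.
Proof.
move=> x0 ys; rewrite -(@iU_bracket false s) // /scom mul1r scalerBl -!scalerA.
by rewrite addrC subrK.
Qed.

Lemma act_odd x y z : x \in gl_parity true -> y \in gl_parity true ->
  x ## (y ## z) = scom true x y ## z - y ## (x ## z).
Proof.
move=> x0 ys; rewrite -(@iU_bracket true true) // /scom expr1 mulN1r opprK scalerDl -!scalerA.
by rewrite addrK.
Qed.

Lemma actC c x z : cU c *: (x ## z) = x ## (cU c *: z).
Proof. by rewrite !scalerA cUC. Qed.

Lemma two_inj z : z + z = 0 -> z = 0.
Proof.
move=> /(congr1 (fun z => cU 2%:R^-1 *: z)); rewrite scaler0 -mulr2n -scaler_nat scalerA.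
by rewrite -(rmorph_nat cU) -rmorphM mulVf // rmorph1 scale1r.
Qed.

Lemma act_signr e x z : x ## ((-1) ^+ e *: z) = (-1) ^+ e *: (x ## z).
Proof. by rewrite !scalerA commr_sign. Qed.

(** * Products of anticommuting root vectors *)

Section Anticommuting.
Variables (P : pred I) (us : seq I).
Hypotheses (us_uniq : uniq us) (usE : us =i P).
Hypothesis P_odd : forall x, x \in span_units F P -> x \in gl_parity true.
Hypothesis P_comm : forall x y, x \in span_units F P -> y \in span_units F P ->
  scom true x y = 0.

Definition uprod t z : Z := foldr (fun a => *:%R (iU (u_ a))) z t.

Lemma uprod_cat t t' z : uprod (t ++ t') z = uprod t (uprod t' z).
Proof. exact: foldr_cat. Qed.

Lemma uprodE t z : uprod t z = (\prod_(a <- t) iU (u_ a)) *: z.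
Proof.
by elim: t => [|a t IH] /=; rewrite ?big_nil ?scale1r // big_cons -scalerA -IH.
Qed.

Lemma uprodB t : zmod_morphism (uprod t).
Proof. by move=> z w; rewrite !uprodE scalerBr. Qed.

Lemma uprodC c t z : cU c *: uprod t z = uprod t (cU c *: z).
Proof. by rewrite !uprodE !scalerA cUC. Qed.

Lemma unit_span a : a \in us -> u_ a \in span_units F P.
Proof. by rewrite usE => Pa; apply: mx_unit_span. Qed.

Lemma act_anti x y z : x \in span_units F P -> y \in span_units F P ->
  x ## (y ## z) = - (y ## (x ## z)).
Proof. by move=> xP yP; rewrite act_odd ?P_odd // P_comm // iU0 scale0r sub0r. Qed.

Lemma act_sqr x z : x \in span_units F P -> x ## (x ## z) = 0.
Proof. by move=> xP; apply: two_inj; rewrite {1}act_anti // addNr. Qed.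

Lemma uprod_anti a t z : a \in us -> {subset t <= us} ->
  uprod t (u_ a ## z) = (-1) ^+ (odd (size t)) *: (u_ a ## uprod t z).
Proof.
move=> aus; elim: t => [|b t IH] tus /=; first by rewrite scale1r.
rewrite IH => [|b' b't]; last by rewrite tus // inE b't orbT.
have bus : b \in us by rewrite tus ?mem_head.
by rewrite act_signr act_anti ?unit_span // scalerN -scaleNr -signrN.
Qed.

Lemma uprod_mem a t z : {subset t <= us} -> a \in t -> u_ a ## uprod t z = 0.
Proof.
elim: t => [//|b t IH] tus; rewrite inE /=; have bus : b \in us by rewrite tus ?mem_head.
have tus' : {subset t <= us} by move=> k kt; rewrite tus // inE kt orbT.
case: eqVneq => [-> _|_ /= at_]; first by rewrite act_sqr ?unit_span.
by rewrite act_anti ?unit_span ?(tus' _ at_) // IH // scaler0 oppr0.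
Qed.

Lemma uprod_dup t z : {subset t <= us} -> ~~ uniq t -> uprod t z = 0.
Proof.
elim: t => [//|a t IH] tus /=; rewrite negb_and negbK.
have tus' : {subset t <= us} by move=> k kt; rewrite tus // inE kt orbT.
by case/orP => [at_|/(IH tus') ->]; [rewrite uprod_mem|rewrite scaler0].
Qed.

Lemma uprod_perm t t' z : {subset t <= us} -> perm_eq t t' ->
  exists e : bool, uprod t z = (-1) ^+ e *: uprod t' z.
Proof.
elim: t' t => [|a t' IH] t tus tt'; first by rewrite (perm_nilP tt'); exists false; rewrite scale1r.
have at_ : a \in t by rewrite (perm_mem tt') mem_head.
case/splitPr: at_ tus tt' => t1 t2 tus tt'.
have aus : a \in us by rewrite tus // mem_cat mem_head orbT.
have [k||e eE] := IH (t1 ++ t2).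
- by rewrite mem_cat => /orP [] kt; rewrite tus // mem_cat ?inE kt ?orbT.
- by rewrite -(perm_cons a) -(permPl (permEl (perm_catCA t1 [:: a] t2))).
rewrite uprod_cat /= uprod_anti // => [|k kt]; last by rewrite tus // mem_cat kt.
rewrite -uprod_cat eE act_signr scalerA -signr_addb; by eexists.
Qed.

(** A word with as many letters as [us] either repeats a letter, and vanishes, or is a permutation
    of [us], and agrees with the full product up to sign. *)
Lemma uprod_full t z : {subset t <= us} -> size t = size us ->
  exists c, uprod t z = cU c *: uprod us z.
Proof.
move=> tus st; case ut: (uniq t); last first.
  by exists 0; rewrite rmorph0 scale0r uprod_dup ?ut.
have [|e ->] := @uprod_perm t us z tus.
  by apply: uniq_perm => //; case: (uniq_min_size ut tus); rewrite ?st.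
by exists ((-1) ^+ e); rewrite rmorph_sign.
Qed.

Definition uspan (k : nat) z : Z -> Prop :=
  zspan_prop (fun w => exists c t, [/\ {subset t <= us}, size t = k & w = cU c *: uprod t z]).

Lemma uspan_prod t z : {subset t <= us} -> uspan (size t) z (uprod t z).
Proof. by move=> tus; apply: zspan_in; exists 1, t; rewrite rmorph1 scale1r. Qed.

Lemma uspan_scale k z c w : uspan k z w -> uspan k z (cU c *: w).
Proof.
move: w; apply: zspan_prop_ind => [w w'||w w' Hw Hw'|w [d [t [tus st ->]]]].
- exact: scalerBr.
- exact: zspan_0.
- exact: zspan_B.
- by apply: zspan_in; exists (c * d), t; rewrite scalerA rmorphM.
Qed.

Lemma uspan_act k z y w : y \in span_units F P -> uspan k z w -> uspan k.+1 z (y ## w).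
Proof.
move=> yP; move: w; apply: zspan_prop_ind => [w w'||w w' Hw Hw'|w [d [t [tus st ->]]]].
- exact: scalerBr.
- exact: zspan_0.
- exact: zspan_B.
- rewrite (span_units_expand us_uniq usE yP) iU_sum scaler_suml; apply: zspan_prop_sum => a aus.
  rewrite -scalerA; apply: uspan_scale; rewrite -actC; apply: uspan_scale.
  rewrite -st; apply: (@uspan_prod (a :: t)) => k'.
  by rewrite inE => /orP [/eqP ->|/tus].
Qed.

Lemma uspan_full z w : uspan (size us) z w -> exists c, w = cU c *: uprod us z.
Proof.
elim=> [{}w [d [t [tus st ->]]]||w1 w2 _ [c1 ->] _ [c2 ->]].
- by have [c ->] := uprod_full z tus st; exists (d * c); rewrite rmorphM scalerA.
- by exists 0; rewrite rmorph0 scale0r.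
- by exists (c1 - c2); rewrite rmorphB scalerBl.
Qed.

(** Commuting [x] through a word replaces one letter at a time by its bracket with [x], so the
    length is kept. At full length, by [uspan_full], the cost is a multiple of the full product. *)
Lemma uspan_gl0 x t z : x \in gl0 -> {subset t <= us} ->
  (forall y, y \in span_units F P -> scom false x y \in span_units F P) ->
  uspan (size t) z (x ## uprod t z - uprod t (x ## z)).
Proof.
move=> x0 + xP; elim: t => [_|a t IH tus] /=; first by rewrite subrr; apply: zspan_0.
have tus' : {subset t <= us} by move=> k kt; rewrite tus // inE kt orbT.
have aP : u_ a \in span_units F P by rewrite unit_span ?tus ?mem_head.
rewrite (@act_even true) ?P_odd // addrAC -scalerBr; apply: zspan_propD.
  by apply: uspan_act => //; apply: IH.
by apply: uspan_act (uspan_prod _ tus'); apply: xP.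
Qed.
End Anticommuting.

(** * Degree and parity in the induced module, and the first implication *)

Section GradedVerma.
Variables (A : pzRingType) (iA : gl_mx -> A) (cA : {rmorphism F -> A}).
Variables (M : lmodType A) (gM : bool -> {pred M}).
Variables (j : M -> Z) (Zgr : bool -> {pred Z}) (pr : Z -> M).
Variables (es fs : seq I).
Hypothesis A_ind : forall Q : A -> Prop,
  (forall f g, Q f -> Q g -> Q (f + g)) -> (forall f g, Q f -> Q g -> Q (f * g)) ->
  (forall c, Q (cA c)) -> (forall x, x \in gl0 -> Q (iA x)) -> forall f, Q f.
Hypothesis U_ind : forall Q : U -> Prop,
  (forall f g, Q f -> Q g -> Q (f + g)) -> (forall f g, Q f -> Q g -> Q (f * g)) ->
  (forall c, Q (cU c)) -> (forall x, Q (iU x)) -> forall f, Q f.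
Hypothesis gM_closed : forall s, zmod_closed (gM s).
Hypothesis gM_dec : forall v, exists2 v0, v0 \in gM false & v - v0 \in gM true.
Hypothesis gM_cap : forall v, v \in gM false -> v \in gM true -> v = 0.
Hypothesis gM_scale : forall s c v, v \in gM s -> cA c *: v \in gM s.
Hypothesis gM_act : forall s x v, x \in gl0 -> v \in gM s -> iA x *: v \in gM s.
Hypothesis simpleM : simple_module gM.
Hypothesis jB : zmod_morphism j.
Hypothesis j_scale : forall c v, cU c *: j v = j (cA c *: v).
Hypothesis j_gl0 : forall x v, x \in gl0 -> x ## j v = j (iA x *: v).
Hypothesis j_gl1 : forall x v, x \in gl1 -> x ## j v = 0.
Hypothesis Z_ind : forall Q : Z -> Prop,
  (forall z w, Q z -> Q w -> Q (z - w)) -> (forall x z, Q z -> Q (x ## z)) ->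
  (forall c z, Q z -> Q (cU c *: z)) -> (forall v, Q (j v)) -> forall z, Q z.
Hypothesis Zgr_ind : forall Q : bool -> Z -> Prop,
  (forall s, Q s 0) -> (forall s z w, Q s z -> Q s w -> Q s (z - w)) ->
  (forall s (t : bool) x z, x \in gl_parity t -> Q s z -> Q (s (+) t) (x ## z)) ->
  (forall s c z, Q s z -> Q s (cU c *: z)) -> (forall s v, v \in gM s -> Q s (j v)) ->
  forall s z, z \in Zgr s -> Q s z.
Hypothesis Zgr_closed : forall s, zmod_closed (Zgr s).
Hypothesis Zgr_act : forall s (t : bool) x z, x \in gl_parity t -> z \in Zgr s ->
  x ## z \in Zgr (s (+) t).
Hypothesis Zgr_scale : forall s c z, z \in Zgr s -> cU c *: z \in Zgr s.
Hypothesis Zgr_j : forall s v, v \in gM s -> j v \in Zgr s.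
Hypothesis prB : zmod_morphism pr.
Hypothesis pr_j : forall v, pr (j v) = v.
Hypothesis pr_glm1 : forall x z, x \in glm1 -> pr (x ## z) = 0.
Hypothesis pr_gl0 : forall x z, x \in gl0 -> pr (x ## z) = iA x *: pr z.
Hypothesis pr_scale : forall c z, pr (cU c *: z) = cA c *: pr z.
Hypotheses (es_uniq : uniq es) (esE : es =i @in_gl1 m n).
Hypotheses (fs_uniq : uniq fs) (fsE : fs =i @in_glm1 m n).
Hypothesis top_inj : forall v, uprod fs (j v) = 0 -> v = 0.
Implicit Types (v : M) (s : bool) (k : nat).

Lemma gM0 s : 0 \in gM s. Proof. by case: (gM_closed s). Qed.
Lemma gMB s v v' : v \in gM s -> v' \in gM s -> v - v' \in gM s.
Proof. by case: (gM_closed s) => _; apply. Qed.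
Lemma gM_sgn s e v : v \in gM s -> (-1) ^+ e *: v \in gM s.
Proof. by move=> vs; rewrite -(rmorph_sign cA); apply: gM_scale. Qed.

Lemma j0 : j 0 = 0. Proof. by rewrite -(subrr 0) jB subrr. Qed.
Lemma jD v v' : j (v + v') = j v + j v'.
Proof. by rewrite -{1}[v']opprK jB -[- v']sub0r jB j0 sub0r opprK. Qed.
Lemma pr0 : pr 0 = 0. Proof. by rewrite -(subrr 0) prB subrr. Qed.

Let glm1_odd := glm1_parity.
Let gl1_odd := gl1_parity.
Lemma glm1_comm x y : x \in glm1 -> y \in glm1 -> scom true x y = 0.
Proof. exact: scomNN. Qed.
Lemma gl1_comm x y : x \in gl1 -> y \in gl1 -> scom true x y = 0.
Proof. exact: scom11. Qed.

(* The elements of degree [-k] and parity [s] *)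
Definition vdeg k s : Z -> Prop := zspan_prop (fun w => exists t v,
  [/\ {subset t <= fs}, size t = k, v \in gM (s (+) odd k) & w = uprod t (j v)]).

Lemma vdeg_prod t s v : {subset t <= fs} -> v \in gM (s (+) odd (size t)) ->
  vdeg (size t) s (uprod t (j v)).
Proof. by move=> tfs vs; apply: zspan_in; exists t, v. Qed.

Lemma vdeg_ind k s (Q : Z -> Prop) : Q 0 -> (forall z w, Q z -> Q w -> Q (z - w)) ->
  (forall t v, {subset t <= fs} -> size t = k -> v \in gM (s (+) odd k) ->
    Q (uprod t (j v))) -> forall w, vdeg k s w -> Q w.
Proof.
move=> Q0 QB Qp; apply: (zspan_prop_ind (g := idfun)) => // w [t [v [tfs st vs ->]]].
exact: Qp.
Qed.

Lemma vdeg_scale k s c w : vdeg k s w -> vdeg k s (cU c *: w).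
Proof.
move: w; apply: vdeg_ind => [|z w|t v tfs <- vs].
- by rewrite scaler0; apply: zspan_0.
- by rewrite scalerBr; apply: zspan_B.
- by rewrite uprodC j_scale; apply: vdeg_prod => //; apply: gM_scale.
Qed.

Lemma vdeg_uspan t s v w : {subset t <= fs} -> v \in gM (s (+) odd (size t)) ->
  uspan fs (size t) (j v) w -> vdeg (size t) s w.
Proof.
move=> _ vs; apply: (zspan_prop_ind (g := idfun)) => // [|w1 w2|w1 [c [t' [tfs st ->]]]].
- exact: zspan_0.
- exact: zspan_B.
- by apply: vdeg_scale; rewrite -st; apply: vdeg_prod => //; rewrite st.
Qed.

Lemma vdeg_glm1 k s y w : y \in glm1 -> vdeg k s w -> vdeg k.+1 (~~ s) (y ## w).
Proof.
move=> yN; move: w; apply: vdeg_ind => [|z w|t v tfs <- vs].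
- by rewrite scaler0; apply: zspan_0.
- by rewrite scalerBr; apply: zspan_B.
- rewrite (span_units_expand fs_uniq fsE yN) iU_sum scaler_suml; apply: zspan_prop_sum => a afs.
  rewrite -scalerA; apply: vdeg_scale; apply: (@vdeg_prod (a :: t)).
    by move=> b; rewrite inE => /orP [/eqP ->|/tfs].
  by rewrite /= addbN addNb negbK.
Qed.

Lemma vdeg_gl0 k s x w : x \in gl0 -> vdeg k s w -> vdeg k s (x ## w).
Proof.
move=> x0; move: w; apply: vdeg_ind => [|z w|t v tfs <- vs].
- by rewrite scaler0; apply: zspan_0.
- by rewrite scalerBr; apply: zspan_B.
- rewrite -[_ ## _](subrK (uprod t (x ## j v))); apply: zspan_propD.
    apply: (@vdeg_uspan t s v) => //; apply: (uspan_gl0 fs_uniq fsE glm1_odd) => // y.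
    exact: scom0N.
  by rewrite j_gl0 //; apply: vdeg_prod => //; apply: gM_act.
Qed.

(** Moving [x] past the first letter $u_a$ leaves $[x,u_a]$ in [gl0], which keeps the length of the
    remaining word, and [x] acting on that shorter word. At the end [x] meets M and kills it. *)
Lemma vdeg_gl1 k s x w : x \in gl1 -> vdeg k s w ->
  if k is k'.+1 then vdeg k' (~~ s) (x ## w) else x ## w = 0.
Proof.
move=> x1; move: w; apply: vdeg_ind => [|z w|t v tfs st vs].
- by case: k => *; rewrite scaler0 //; apply: zspan_0.
- case: k => [zx wx|k]; first by rewrite scalerBr zx wx subr0.
  by rewrite scalerBr; apply: zspan_B.
elim: t k s st tfs vs => [|a t IH] [|k] s //= => [_ _ _|[st] tfs vs]; first exact: j_gl1.
have tfs' : {subset t <= fs} by move=> b bt; rewrite tfs // inE bt orbT.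
have aN : u_ a \in glm1 by apply: (unit_span fsE); rewrite tfs ?mem_head.
have vs' : v \in gM (~~ s (+) odd (size t)) by rewrite addNb -addbN st.
rewrite (act_odd _ (gl1_parity x1) (glm1_parity aN)); apply: zspan_B.
  by apply: vdeg_gl0; [apply: scom1N|rewrite -st; apply: vdeg_prod].
have := IH k (~~ s) st tfs' _; rewrite -st => /(_ vs'); rewrite st.
case: (k) => [->|k']; first by rewrite scaler0; apply: zspan_0.
by rewrite negbK => /(vdeg_glm1 aN).
Qed.

Lemma pr_vdeg k s w : vdeg k.+1 s w -> pr w = 0.
Proof.
move: w; apply: vdeg_ind => [|z w zx wx|[//|a t] v tfs _ _]; first exact: pr0.
  by rewrite prB zx wx subrr.
by apply: pr_glm1; apply: (unit_span fsE); rewrite tfs ?mem_head.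
Qed.

Lemma vdeg0_j s w : vdeg 0 s w -> exists2 v, v \in gM s & w = j v.
Proof.
move: w; apply: vdeg_ind => [|z w [v vs ->] [v' vs' ->]|[|//] v _ _].
- by exists 0; rewrite ?gM0 ?j0.
- by exists (v - v'); rewrite ?gMB ?jB.
- by rewrite addbF; exists v.
Qed.

Lemma vdeg_uprod_es k s t w : {subset t <= es} -> vdeg (size t + k) s w ->
  vdeg k (s (+) odd (size t)) (uprod t w).
Proof.
elim: t k => [|a t IH] k tes /=; first by rewrite addbF.
have tes' : {subset t <= es} by move=> b bt; rewrite tes // inE bt orbT.
have a1 : u_ a \in gl1 by apply: (unit_span esE); rewrite tes ?mem_head.
by rewrite addSnnS => /(IH _ tes') /(vdeg_gl1 a1); rewrite addbN.
Qed.

Definition vhom s : Z -> Prop := zspan_prop (fun w => exists k, vdeg k s w).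

(** Sums of words in [glm1] applied to M are stable under all generators. This is the spanning half
    of PBW; [pr] and [top_inj] supply the independence. *)
Lemma Zgr_vhom s z : z \in Zgr s -> vhom s z.
Proof.
have vdeg_vhom k s' w : vdeg k s' w -> vhom s' w by move=> wk; apply: zspan_in; exists k.
have act_vhom s' (t : bool) (x : gl_mx) : (forall k w, vdeg k s' w -> vhom t (x ## w)) ->
    forall w, vhom s' w -> vhom t (x ## w).
  move=> xw; apply: zspan_prop_ind => [w w'||w w'|w [k wk]]; first exact: scalerBr.
  - exact: zspan_0.
  - exact: zspan_B.
  - exact: xw wk.
move: s z; apply: Zgr_ind => [s|s z w|s t x z xt|s c z|s v vs].
- exact: zspan_0.
- exact: zspan_B.
- case: t xt => [/memv_addP [y yN [y' y1 ->]]|x0] zs.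
    rewrite iUD scalerDl addbT; apply: zspan_propD; move: z zs; apply: act_vhom => k w wk.
      by apply: vdeg_vhom (vdeg_glm1 yN wk).
    have := vdeg_gl1 y1 wk; case: k {wk} => [->|k wk]; first exact: zspan_0.
    exact: vdeg_vhom wk.
  by rewrite addbF; move: z zs; apply: act_vhom => k w wk; apply: vdeg_vhom (vdeg_gl0 x0 wk).
- move: z; apply: zspan_prop_ind => [w w'||w w'|w [k wk]]; first exact: scalerBr.
  + exact: zspan_0.
  + exact: zspan_B.
  + exact: vdeg_vhom (vdeg_scale c wk).
- by apply: (@vdeg_vhom 0); apply: (@vdeg_prod [::]); rewrite //= addbF.
Qed.

Lemma pr_Zgr s z : z \in Zgr s -> pr z \in gM s.
Proof.
move/Zgr_vhom; move: z; apply: (zspan_prop_ind (T := fun v => v \in gM s)) => //.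
- exact: gM0.
- by move=> v v'; apply: gMB.
move=> z [[|k]]; last by move/pr_vdeg ->; apply: gM0.
by case/vdeg0_j => v vs ->; rewrite pr_j.
Qed.

Lemma gl_split x : exists y : gl_mx, y \in glm1 /\ x = y + diag_part x + up_part x.
Proof.
exists (x - diag_part x - up_part x); split; last by rewrite addrAC !subrK.
apply/span_unitsP => i k; rewrite /in_glm1 /= => nik.
rewrite !mxE /in_gl1 /=; case: (low i) nik; case: (low k) => //= _;
  by rewrite ?subrr ?subr0 ?subrr.
Qed.

Lemma Zgr_dec z : exists z0 z1, [/\ z0 \in Zgr false, z1 \in Zgr true & z = z0 + z1].
Proof.
have ZB s w w' : w \in Zgr s -> w' \in Zgr s -> w - w' \in Zgr s.
  by case: (Zgr_closed s) => _; apply.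
have Z0 s : 0 \in Zgr s by case: (Zgr_closed s).
have ZD s w w' : w \in Zgr s -> w' \in Zgr s -> w + w' \in Zgr s.
  by move=> ws ws'; rewrite -[w']opprK -[- w']sub0r; apply: (ZB) => //; apply: ZB.
move: z; apply: Z_ind.
- move=> z w [z0 [z1 [z0s z1s ->]]] [w0 [w1 [w0s w1s ->]]].
  by exists (z0 - w0), (z1 - w1); rewrite opprD addrACA; split; rewrite ?ZB.
- move=> x z [z0 [z1 [z0s z1s ->]]]; have [y [yN ->]] := gl_split x.
  have dx := @diag_part_gl0 F m n x; have ux := gl1_parity (up_part_gl1 x).
  have yo := glm1_parity yN; move: (diag_part x) (up_part x) dx ux => d u d0 u1.
  exists (d ## z0 + (y ## z1 + u ## z1)), (d ## z1 + (y ## z0 + u ## z0)).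
  have A0 x' w s : x' \in gl0 -> w \in Zgr s -> x' ## w \in Zgr s.
    by move=> x0 ws; rewrite -[s]addbF; apply: Zgr_act.
  have A1 x' w s : x' \in gl_parity true -> w \in Zgr s -> x' ## w \in Zgr (~~ s).
    by move=> x0 ws; rewrite -addbT; apply: Zgr_act.
  split; first by apply: (ZD); [apply: A0|apply: (ZD); apply: (A1 _ _ true)].
    by apply: (ZD); [apply: A0|apply: (ZD); apply: (A1 _ _ false)].
  rewrite !iUD !scalerDl !scalerDr [X in X + _]addrC -addrA [in RHS]addrACA; congr (_ + _).
  by rewrite [in RHS]addrACA; congr (_ + _); apply: addrC.
- move=> c z [z0 [z1 [z0s z1s ->]]].
  by exists (cU c *: z0), (cU c *: z1); rewrite scalerDr !Zgr_scale.
- move=> v; have [v0 v0s v1s] := gM_dec v; exists (j v0), (j (v - v0)).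
  by rewrite !Zgr_j // -jD addrC subrK.
Qed.

(** The set defined by [T] need not be graded, while simplicity of M tests graded submodules only.
    So [N] collects the sums of an even and an odd vector both satisfying [T]; the starting vector
    lies in it because it is homogeneous. *)
Lemma simple_gen (T : M -> Prop) : T 0 -> (forall v v', T v -> T v' -> T (v - v')) ->
  (forall c v, T v -> T (cA c *: v)) -> (forall x v, x \in gl0 -> T v -> T (iA x *: v)) ->
  forall s v, v \in gM s -> v != 0 -> T v -> forall v', T v'.
Proof.
move=> T0 TB Tc Tx s v vs v0 Tv.
have TD v1 v2 : T v1 -> T v2 -> T (v1 + v2).
  by move=> T1 T2; rewrite -[v2]opprK -[- v2]sub0r; apply: (TB) => //; apply: TB.
have gMD s' v1 v2 : v1 \in gM s' -> v2 \in gM s' -> v1 + v2 \in gM s'.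
  by move=> m1 m2; rewrite -[v2]opprK -[- v2]sub0r; apply: gMB => //; apply: gMB => //; apply: gM0.
pose N : {pred M} := fun u => `[< exists v0 v1,
  [/\ v0 \in gM false, v1 \in gM true, u = v0 + v1, T v0 & T v1] >].
have NP u : reflect (exists v0 v1,
  [/\ v0 \in gM false, v1 \in gM true, u = v0 + v1, T v0 & T v1]) (u \in N) by apply: asboolP.
have ND u u' : u \in N -> u' \in N -> u + u' \in N.
  move=> /NP [a0 [a1 [a0s a1s -> Ta0 Ta1]]] /NP [b0 [b1 [b0s b1s -> Tb0 Tb1]]].
  by apply/NP; exists (a0 + b0), (a1 + b1); rewrite addrACA; split; auto.
have NZ f u : u \in N -> f *: u \in N.
  move: f u; apply: A_ind => [f g Hf Hg u uN|f g Hf Hg u uN|c u|x x0 u].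
  - by rewrite scalerDl ND ?Hf ?Hg.
  - by rewrite -scalerA Hf // Hg.
  - move=> /NP [a0 [a1 [a0s a1s -> Ta0 Ta1]]]; apply/NP.
    by exists (cA c *: a0), (cA c *: a1); rewrite scalerDr; split; auto.
  - move=> /NP [a0 [a1 [a0s a1s -> Ta0 Ta1]]]; apply/NP.
    by exists (iA x *: a0), (iA x *: a1); rewrite scalerDr; split; auto.
have NT u : u \in N -> T u by move=> /NP [a0 [a1 [_ _ -> Ta0 Ta1]]]; apply: TD.
have vN : v \in N.
  apply/NP; case: s vs => vs; [exists 0, v|exists v, 0];
    by rewrite ?add0r ?addr0; split=> //; apply: gM0.
have [|N0|NA v'] := simpleM.2 N; last exact/NT/NA.
- split=> [|u /NP [a0 [a1 [a0s a1s -> Ta0 Ta1]]]].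
    split=> [|f u u' uN u'N]; last by rewrite ND ?NZ.
    by apply/NP; exists 0, 0; rewrite addr0; split=> //; apply: gM0.
  exists a0, a1; split=> //; apply/NP; [exists a0, 0|exists 0, a1];
    by rewrite ?add0r ?addr0; split=> //; apply: gM0.
- by move: v0; rewrite (N0 _ vN) eqxx.
Qed.

Lemma submod_all (N : {pred Z}) : submod_closed N -> (forall v, j v \in N) -> forall z, z \in N.
Proof.
move=> [N0 NL] Nj; have NZ f z : z \in N -> f *: z \in N.
  by move=> zN; rewrite -[_ *: z]addr0; apply: NL.
apply: Z_ind => [z w zN wN|x z zN|c z zN|v]; rewrite ?NZ //.
by rewrite addrC -scaleN1r; apply: NL.
Qed.

(* The elements of parity [s] of the form [\sum_(t' subseq of t) uprod t' (j v_t')];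
   the nested form drives the induction of [upoly_reach]. *)
Fixpoint upoly t s : Z -> Prop :=
  if t is a :: t' then
    fun z => exists z1 z2, [/\ upoly t' (~~ s) z1, upoly t' s z2 & z = u_ a ## z1 + z2]
  else fun z => exists2 v, v \in gM s & z = j v.

Lemma upolyB t s z w : upoly t s z -> upoly t s w -> upoly t s (z - w).
Proof.
elim: t s z w => [|a t IH] s z w /=.
  by move=> [v vs ->] [v' vs' ->]; exists (v - v'); rewrite ?gMB ?jB.
move=> [z1 [z2 [z1s z2s ->]]] [w1 [w2 [w1s w2s ->]]].
exists (z1 - w1), (z2 - w2); rewrite scalerBr opprD addrACA.
by split; [apply: IH|apply: IH|].
Qed.

Lemma upoly0 t s : upoly t s 0.
Proof.
elim: t s => [|a t IH] s /=; first by exists 0; rewrite ?gM0 ?j0.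
by exists 0, 0; rewrite scaler0 addr0.
Qed.

Lemma upoly_j t s v : v \in gM s -> upoly t s (j v).
Proof.
elim: t s => [|a t IH] s vs /=; first by exists v.
by exists 0, (j v); rewrite scaler0 add0r; split=> //; [apply: upoly0|apply: IH].
Qed.

Lemma upoly_act t s b z : {subset t <= fs} -> b \in t -> upoly t s z ->
  upoly t (~~ s) (u_ b ## z).
Proof.
elim: t s z => [//|a t IH] s z tfs /= + [z1 [z2 [z1s z2s ->]]].
have aN := unit_span fsE (tfs _ (mem_head a t)).
have tfs' : {subset t <= fs} by move=> k kt; rewrite tfs // inE kt orbT.
rewrite inE scalerDr; case: eqVneq => [-> _|_ /= bt].
  rewrite (act_sqr glm1_odd glm1_comm) // add0r; exists z2, 0.
  by rewrite negbK addr0; split=> //; apply: upoly0.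
have bN := unit_span fsE (tfs' _ bt).
exists (- (u_ b ## z1)), (u_ b ## z2).
rewrite scalerN -(act_anti glm1_odd glm1_comm) //; split=> //; last exact: IH.
by rewrite -sub0r; apply: upolyB; [apply: upoly0|apply: IH].
Qed.

Lemma upoly_uprod l t s v : {subset t <= fs} -> {subset l <= t} -> v \in gM s ->
  upoly t (s (+) odd (size l)) (uprod l (j v)).
Proof.
move=> tfs + vs; elim: l => [|a l IH] lt /=; first by rewrite addbF; apply: upoly_j.
rewrite addbN; apply: upoly_act => //; first by rewrite lt ?mem_head.
by apply: IH => k kl; rewrite lt // inE kl orbT.
Qed.

Lemma Zgr_upoly s z : z \in Zgr s -> upoly fs s z.
Proof.
move/Zgr_vhom; apply: (zspan_prop_ind (g := idfun)) => // [|w w'|w [k]].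
- exact: upoly0.
- exact: upolyB.
apply: vdeg_ind => [|w1 w2|t v tfs <- vs]; [exact: upoly0|exact: upolyB|].
by have := upoly_uprod (fun _ => id) tfs vs; rewrite -addbA addbb addbF.
Qed.

(** Write $z=u_a z_1+z_2$. If $z_2\neq 0$, the extra letter $u_a$ kills the first term, as its
    square acts by zero, and completes the word obtained from $z_2$. If $z_2=0$, the letter $u_a$ is
    already present and moves to the front, with its sign absorbed into [v]. *)
Lemma upoly_reach t s z : uniq t -> {subset t <= fs} -> upoly t s z -> z != 0 ->
  exists l s' v, [/\ {subset l <= fs}, v \in gM s', v != 0 & uprod l z = uprod t (j v)].
Proof.
elim: t s z => [|a t IH] s z /=.
  move=> _ _ [v vs ->] jv0; exists [::], s, v; split=> //.
  by apply: contraNneq jv0 => ->; rewrite j0.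
move=> /andP [_ ut] tfs [z1 [z2 [z1s z2s ->]]].
have afs := tfs _ (mem_head a t); have aN := unit_span fsE afs.
have tfs' : {subset t <= fs} by move=> k kt; rewrite tfs // inE kt orbT.
have anti := uprod_anti fsE glm1_odd glm1_comm _ afs.
have [->|z20 _] := eqVneq z2 0.
  rewrite addr0 => az1; have z10 : z1 != 0 by apply: contraNneq az1 => ->; rewrite scaler0.
  have [l [s' [v [lfs vs v0 lz1]]]] := IH _ _ ut tfs' z1s z10.
  exists l, s', ((-1) ^+ odd (size l) *: v); split=> //; first exact: gM_sgn.
    apply: contraNneq v0 => /(congr1 ( *:%R ((-1) ^+ odd (size l)))).
    by rewrite scalerA -signr_addb addbb scale1r scaler0 => ->.
  rewrite anti // lz1 -(rmorph_sign cU) actC; congr (_ ## _).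
  by rewrite -(rmorph_sign cA) -j_scale uprodC.
have [l [s' [v [lfs vs v0 lz2]]]] := IH _ _ ut tfs' z2s z20.
exists (a :: l), s', v; split=> //=.
  by move=> k; rewrite inE => /orP [/eqP ->|/lfs].
have -> : uprod l (u_ a ## z1 + z2) = uprod l (u_ a ## z1) + uprod l z2.
  by rewrite !uprodE scalerDr.
by rewrite anti // scalerDr act_signr (act_sqr glm1_odd glm1_comm) // scaler0 add0r lz2.
Qed.

(** Transposing indices exchanges the two sets. The equality is what makes $e_1\cdots e_l$ bring the
    top degree exactly back to M. *)
Lemma size_es : size es = size fs.
Proof.
have -> : size fs = size [seq (a.2, a.1) | a <- fs] by rewrite size_map.
apply/perm_size/uniq_perm => //; first by rewrite map_inj_uniq // => -[a b] [a' b'] [-> ->].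
move=> [a b]; rewrite esE; apply/idP/mapP => [ab|[[b' a'] ba [-> ->]]].
  by exists (b, a) => //; rewrite fsE; move: ab; rewrite !unfold_in /in_gl1 /in_glm1 /= andbC.
by move: ba; rewrite fsE !unfold_in /in_gl1 /in_glm1 /= andbC.
Qed.

Lemma graded_verma_simple v f1 : v != 0 ->
  uprod es (uprod fs (j v)) = cU f1 *: j v -> f1 <> 0 -> simple_module Zgr.
Proof.
move=> v0 f1P f10; have jv0 : j v != 0.
  by apply: contraNneq v0 => jv; rewrite -(pr_j v) jv pr0.
split=> [|N [subN grN]]; first by exists (j v).
have [N0 NL] := subN; have NZ f z : z \in N -> f *: z \in N.
  by move=> zN; rewrite -[_ *: z]addr0; apply: NL.
have NB z w : z \in N -> w \in N -> z - w \in N.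
  by move=> zN wN; rewrite addrC -scaleN1r; apply: NL.
have Nprod t z : z \in N -> uprod t z \in N by rewrite uprodE; apply: NZ.
have [[z [zN z0]]|noz] := EM (exists z, z \in N /\ z != 0); last first.
  by left=> z zN; apply: contra_notP noz => /eqP z0; exists z.
right; have [s [y [ys yN y0]]] : exists s (y : Z), [/\ y \in Zgr s, y \in N & y != 0].
  have [z0' [z1' [z0s z1s z0N z1N zE]]] := grN z zN.
  have [z00|z00] := eqVneq z0' 0; last by exists false, z0'.
  by exists true, z1'; split=> //; rewrite zE z00 add0r in z0.
have [l [s' [u [lfs us u0 lu]]]] := upoly_reach fs_uniq (fun _ => id) (Zgr_upoly ys) y0.
have T1 (w : M) : uprod fs (j w) \in N.
  move: w; apply: (@simple_gen (fun w : M => uprod fs (j w) \in N)) (us) (u0) _.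
  - by rewrite j0 uprodE scaler0.
  - by move=> w w' wN w'N; rewrite jB uprodB NB.
  - by move=> c w wN; rewrite -j_scale -uprodC NZ.
  - move=> x w x0 wN; rewrite -j_gl0 //.
    (* Commuting [x] past the top product costs only a multiple of that product, so [N] contains the
       top product applied to $x w$ as well. *)
    have [|c cE] := uspan_full fs_uniq fsE glm1_odd glm1_comm
      (uspan_gl0 fs_uniq fsE glm1_odd (j w) x0 (fun _ => id) _).
      by move=> y'; apply: scom0N.
    move/eqP: cE; rewrite subr_eq addrC -subr_eq => /eqP <-.
    by rewrite NB ?NZ.
  - by rewrite -lu Nprod.
have T2 (w : M) s1 : w \in gM s1 -> exists2 w', w' \in gM s1 & uprod es (uprod fs (j w)) = j w'.
  move=> ws.
  have := @vdeg_uprod_es 0 (s1 (+) odd (size fs)) es (uprod fs (j w)) (fun _ => id).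
  rewrite addn0 size_es => /(_ (vdeg_prod _ _)) /=.
  rewrite -addbA addbb addbF => /(_ (fun _ => id)) /(_ ws).
  by case/vdeg0_j => w' ws' ->; exists w'.
(* [simple_gen] wants a homogeneous vector, so [v] is split. The operator $e_1\cdots e_l f_1\cdots
   f_l$ preserves parity on M, and since $f_1(\lambda)\neq 0$ the images of the two parts cannot
   both vanish. *)
have [v0' v0s v1s] := gM_dec v.
have [w0 w0s w0E] := T2 _ _ v0s; have [w1 w1s w1E] := T2 _ _ v1s.
have T2N (w : M) s1 : w \in gM s1 -> w != 0 -> j w \in N -> forall z, z \in N.
  move=> ws w0' wN; apply: submod_all => //.
  apply: (@simple_gen (fun w : M => j w \in N)) (ws) (w0') wN; first by rewrite j0.
  - by move=> w2 w3 w2N w3N; rewrite jB NB.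
  - by move=> c w2 w2N; rewrite -j_scale NZ.
  - by move=> x w2 x0 w2N; rewrite -j_gl0 // NZ.
have [w00|w00] := eqVneq w0 0; last by apply: (T2N w0 _ w0s w00); rewrite -w0E Nprod ?T1.
apply: (T2N w1 _ w1s); last by rewrite -w1E Nprod ?T1.
apply: contraNneq jv0 => w10; have : uprod es (uprod fs (j v)) = 0.
  have -> : v = v0' + (v - v0') by rewrite addrC subrK.
  have uD t (a b : Z) : uprod t (a + b) = uprod t a + uprod t b by rewrite !uprodE scalerDr.
  by rewrite jD !uD w0E w1E w00 w10 j0 addr0.
rewrite f1P => /(congr1 ( *:%R (cU f1^-1))).
by rewrite scaler0 scalerA -rmorphM mulVf ?rmorph1 ?scale1r // => [->//|]; apply/eqP.
Qed.

(** * The radical of the induced module, and the second implication *)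

Definition xprod (l : seq gl_mx) z : Z := foldr (fun x => *:%R (iU x)) z l.

Lemma xprodE l z : xprod l z = (\prod_(x <- l) iU x) *: z.
Proof.
by elim: l => [|x l IH] /=; rewrite ?big_nil ?scale1r // big_cons -scalerA -IH.
Qed.

Lemma xprod_rcons l x z : xprod (rcons l x) z = xprod l (x ## z).
Proof. exact: foldr_rcons. Qed.

Lemma xprodB l : zmod_morphism (xprod l).
Proof. by move=> z w; rewrite !xprodE scalerBr. Qed.

Lemma xprod0 l : xprod l 0 = 0.
Proof. by rewrite xprodE scaler0. Qed.

(** Each letter raises the degree by one and [pr] sees degree zero only: a word that is too short
    does not reach it, and one that is too long gives zero. *)
Lemma pr_xprod_vdeg l k s w : vdeg k s w -> {subset l <= gl1} -> size l != k ->
  pr (xprod l w) = 0.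
Proof.
elim/last_ind: l k s w => [|l x IH] k s w wk lP; first by case: k wk => // k /pr_vdeg.
rewrite size_rcons xprod_rcons; have x1 : x \in gl1 by rewrite lP // mem_rcons mem_head.
have lP' : {subset l <= gl1} by move=> y yl; rewrite lP // mem_rcons inE yl orbT.
have := vdeg_gl1 x1 wk; case: k {wk} => [->|k wk]; first by rewrite xprod0 pr0.
by rewrite eqSS; apply: IH wk lP'.
Qed.

(* The largest submodule contained in the kernel of [pr], see [vradical_submod] *)
Definition vradical : {pred Z} :=
  fun z => `[< forall l : seq gl_mx, {subset l <= gl1} -> pr (xprod l z) = 0 >].

Lemma vradicalP z :
  reflect (forall l : seq gl_mx, {subset l <= gl1} -> pr (xprod l z) = 0) (z \in vradical).
Proof. exact: asboolP. Qed.

Lemma vradicalB z w : z \in vradical -> w \in vradical -> z - w \in vradical.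
Proof.
move=> /vradicalP zR /vradicalP wR; apply/vradicalP => l lP.
by rewrite xprodB prB zR ?wR ?subrr.
Qed.

Lemma vradical_scale c z : z \in vradical -> cU c *: z \in vradical.
Proof.
move=> /vradicalP zR; apply/vradicalP => l lP.
have -> : xprod l (cU c *: z) = cU c *: xprod l z by rewrite !xprodE !scalerA cUC.
by rewrite pr_scale zR ?scaler0.
Qed.

Lemma vradical_gl1 x z : x \in gl1 -> z \in vradical -> x ## z \in vradical.
Proof.
move=> x1 /vradicalP zR; apply/vradicalP => l lP; rewrite -xprod_rcons zR // => y.
by rewrite mem_rcons inE => /orP [/eqP ->|/lP].
Qed.

(** Induction from the letter nearest to [z]: commuting [x] past [y] leaves $[x,y]$, which is itself
    a letter. This is why words are made of arbitrary elements of [gl1] and not of matrix units. *)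
Lemma vradical_gl0 x z : x \in gl0 -> z \in vradical -> x ## z \in vradical.
Proof.
move=> x0 zR; apply/vradicalP => l; elim/last_ind: l z zR => [|l y IH] z zR lP.
  by move/vradicalP: zR => /(_ [::]) zR; rewrite pr_gl0 // zR ?scaler0.
have y1 : y \in gl1 by rewrite lP // mem_rcons mem_head.
have lP' : {subset l <= gl1} by move=> k kl; rewrite lP // mem_rcons inE kl orbT.
have -> : xprod (rcons l y) (x ## z) = xprod l (x ## (y ## z)) - xprod l (scom false x y ## z).
  by rewrite xprod_rcons -xprodB (act_even _ x0 (gl1_parity y1)) addrK.
rewrite prB IH ?vradical_gl1 // sub0r.
by have /vradicalP -> := vradical_gl1 (scom01 false x0 y1) zR; rewrite ?oppr0.
Qed.

(** The empty word is [pr_glm1]. For a longer one, commuting [x] past the last letter leaves a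
    bracket in [gl0], already handled. *)
Lemma vradical_glm1 x z : x \in glm1 -> z \in vradical -> x ## z \in vradical.
Proof.
move=> xN zR; apply/vradicalP => l; elim/last_ind: l z zR => [|l y IH] z zR lP.
  exact: pr_glm1.
have y1 : y \in gl1 by rewrite lP // mem_rcons mem_head.
have lP' : {subset l <= gl1} by move=> k kl; rewrite lP // mem_rcons inE kl orbT.
rewrite xprod_rcons (act_odd _ (gl1_parity y1) (glm1_parity xN)) xprodB prB.
rewrite IH ?vradical_gl1 // subr0.
by have /vradicalP -> := vradical_gl0 (scom1N true y1 xN) zR.
Qed.

Lemma vradical_submod : submod_closed vradical.
Proof.
have R0 : 0 \in vradical by apply/vradicalP => l _; rewrite xprod0 pr0.
have RD z w : z \in vradical -> w \in vradical -> z + w \in vradical.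
  by move=> zR wR; rewrite -[w]opprK -[- w]sub0r !vradicalB.
split=> // f z w zR wR; apply: (RD) => //.
move: f z zR {w wR}; apply: U_ind => [f g Hf Hg z zR|f g Hf Hg z zR|c z|x z zR].
- by rewrite scalerDl RD ?Hf ?Hg.
- by rewrite -scalerA Hf ?Hg.
- exact: vradical_scale.
- have [y [yN ->]] := gl_split x; rewrite !iUD !scalerDl !RD //.
  + exact: vradical_glm1.
  + by apply: vradical_gl0 => //; apply: diag_part_gl0.
  + by apply: vradical_gl1 => //; apply: up_part_gl1.
Qed.

Lemma xprod_Zgr l s z : {subset l <= gl1} -> z \in Zgr s ->
  xprod l z \in Zgr (s (+) odd (size l)).
Proof.
move=> + zs; elim: l => [|x l IH] lP /=; first by rewrite addbF.
have x1 : x \in gl1 by rewrite lP ?mem_head.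
have lP' : {subset l <= gl1} by move=> k kl; rewrite lP // inE kl orbT.
by rewrite addbN -addbT; apply: Zgr_act; [apply: gl1_parity|apply: IH].
Qed.

(** For a fixed word, the values of [pr] at the two homogeneous components lie in opposite
    components of M, so they cannot cancel and vanish separately. *)
Lemma vradical_graded : graded_submodule Zgr vradical.
Proof.
split=> [|z zR]; first exact: vradical_submod.
have [z0 [z1 [z0s z1s zE]]] := Zgr_dec z; exists z0, z1.
suff z0R : z0 \in vradical.
  by split=> //; have -> : z1 = z - z0 by [rewrite zE addrC addKr]; apply: vradicalB.
apply/vradicalP => l lP; move/vradicalP: zR => /(_ l lP).
rewrite zE -[z1]opprK -[- z1]sub0r xprodB prB xprodB xprod0 sub0r => /eqP.
rewrite subr_eq0 => /eqP pE.
have p0 := pr_Zgr (xprod_Zgr lP z0s); have p1 := pr_Zgr (xprod_Zgr lP z1s).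
have p1' : pr (xprod l z0) \in gM (true (+) odd (size l)).
  rewrite pE -sub0r prB; apply: gMB => //; rewrite pr0; exact: gM0.
by apply: gM_cap; case: (odd (size l)) p0 p1'.
Qed.

Lemma graded_verma_not_simple v : v != 0 ->
  uprod es (uprod fs (j v)) = 0 -> ~ simple_module Zgr.
Proof.
move=> v0 f1P [_ /(_ _ vradical_graded) [R0|RA]]; last first.
  move/vradicalP: (RA (j v)) => /(_ [::]); rewrite /= pr_j => v00.
  by move: v0; rewrite v00 ?eqxx.
suff /R0/top_inj v00 : uprod fs (j v) \in vradical by rewrite v00 eqxx in v0.
(* A word of full length is a multiple of $e_1\cdots e_l$, which kills the top vector by hypothesis;
   words of other lengths vanish for reasons of degree. *)
apply/vradicalP => l lP; have [sl|sl] := eqVneq (size l) (size es).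
  have : uspan es (size l) (uprod fs (j v)) (xprod l (uprod fs (j v))).
    elim: l lP {sl} => [|x l IH] lP /=; first exact: (uspan_prod _ (t := [::])).
    apply: (uspan_act es_uniq esE); first by rewrite lP ?mem_head.
    by apply: IH => k kl; rewrite lP // inE kl orbT.
  rewrite sl => /(uspan_full es_uniq esE gl1_odd gl1_comm) [c ->].
  by rewrite f1P scaler0 pr0.
(* [vdeg] records a parity, so the degree argument is applied to the even and odd parts of [v]
   separately. *)
have [v0' v0s v1s] := gM_dec v.
have top_deg s (w : M) : w \in gM s -> pr (xprod l (uprod fs (j w))) = 0.
  move=> ws; apply: (@pr_xprod_vdeg l (size fs) (s (+) odd (size fs))) => //; last by rewrite -size_es.
  by apply: vdeg_prod => //; rewrite -addbA addbb addbF.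
have -> : v = (v - v0') - (- v0') by rewrite opprK subrK.
rewrite jB uprodB xprodB prB (top_deg true) // (top_deg false) ?subrr //.
by rewrite -sub0r; apply: gMB => //; apply: gM0.
Qed.
End GradedVerma.
End GradedInduction.

(** * The graded baby Verma module *)

Section BabyVermaStructure.
Variables (F : fieldType) (m n p : nat) (chi : {scalar subvs_of (@gl0 F m n)}).
Local Notation gl_mx := 'M[F]_(m + n).
Local Notation U := (uenv (@gl F m n) p chi).
Local Notation A := (uenv (@gl0 F m n) p chi).
Local Notation iU := (uenv_in (@gl F m n) p chi).
Local Notation cU := (uenv_scalar (@gl F m n) p chi).
Local Notation iA := (uenv_in (@gl0 F m n) p chi).
Local Notation cA := (uenv_scalar (@gl0 F m n) p chi).
Variables (M : lmodType A) (gM : bool -> {pred M}).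
Local Notation Z := (baby_verma M).
Local Notation j := (@bv_in F m n p chi M : M -> Z).

Lemma uenv_in_scom s t (x y : gl_mx) : x \in gl_parity s -> y \in gl_parity t ->
  scom (s && t) (iU x) (iU y) = iU (scom (s && t) x y).
Proof.
by move=> xs yt; rewrite /scom uenv_in_bracket ?mem_gl // sbracketE.
Qed.

Lemma uenv_gr_scalar (W : {vspace gl_mx}) c :
  uenv_scalar W p chi c \in uenv_gr W p chi false.
Proof. by apply/zspanP/zspan_in; exists c, [::]; rewrite !big_nil mulr1. Qed.

Lemma uenv_gr_in (W : {vspace gl_mx}) s (x : gl_mx) : x \in W -> x \in gl_parity s ->
  uenv_in W p chi x \in uenv_gr W p chi s.
Proof.
move=> xW xs; apply/zspanP/zspan_in; exists 1, [:: (s, x)].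
by rewrite !big_seq1 /= xW xs rmorph1 mul1r.
Qed.

Lemma bv_tens_in (a : U) (x : M) : bv_tens a x = a *: j x.
Proof. by rewrite -[j x]/(bv_tens 1 x) bv_tensE mulr1. Qed.

Lemma bv_in_zmod : zmod_morphism j.
Proof.
move=> x y; apply/eqP; rewrite eq_sym subr_eq; apply/eqP.
rewrite -[RHS](@tensDr _ _ (@uenv_incl F m n p chi) (restr (@uenv_proj F m n p chi) M)).
by rewrite /bv_in; congr tens; rewrite subrK.
Qed.

Lemma bv_in_scale c (x : M) : cU c *: j x = j (cA c *: x).
Proof.
rewrite /bv_in tprod_scaleE mulr1.
have inclC : uenv_incl (uenv_scalar gl_plus p chi c) = cU c by apply: uenv_liftC.
have projC : uenv_proj (uenv_scalar gl_plus p chi c) = cA c by apply: uenv_liftC.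
by rewrite -[cU c]mul1r -inclC tens_balanced restr_scaleE /= projC.
Qed.

Lemma bv_gen_ind (Q : Z -> Prop) : (forall z w, Q z -> Q w -> Q (z - w)) ->
  (forall x z, Q z -> Q (iU x *: z)) -> (forall c z, Q z -> Q (cU c *: z)) ->
  (forall v, Q (j v)) -> forall z, Q z.
Proof.
move=> QB QX Qc Qj; have QD z w : Q z -> Q w -> Q (z + w).
  move=> Qz Qw; rewrite -[w]opprK -[- w]sub0r; apply: (QB) => //; apply: (QB) => //.
  by rewrite -(subrr (j 0)); apply: QB.
apply: bv_ind => // a x; rewrite bv_tens_in; move: (j x) (Qj x); move: a.
apply: uenv_ind => [a b Ha Hb z Qz|a b Ha Hb z Qz|c z|y _ z]; last exact: QX.
- by rewrite scalerDl; apply: QD; [apply: Ha|apply: Hb].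
- by rewrite -scalerA; apply/Ha/Hb.
- exact: Qc.
Qed.

Definition bv_homog s (z : Z) : Prop := exists t (a : U) (x : M),
  [/\ a \in uenv_gr gl p chi t, x \in gM (s (+) t) & z = bv_tens a x].

Lemma baby_verma_grP s z : reflect (zspan_prop (bv_homog s) z) (z \in baby_verma_gr gM s).
Proof. exact: zspanP. Qed.

Lemma baby_verma_gr_ind (Q : bool -> Z -> Prop) : (forall s, Q s 0) ->
  (forall s z w, Q s z -> Q s w -> Q s (z - w)) ->
  (forall s t x z, x \in gl_parity t -> Q s z -> Q (s (+) t) (iU x *: z)) ->
  (forall s c z, Q s z -> Q s (cU c *: z)) -> (forall s v, v \in gM s -> Q s (j v)) ->
  forall s z, z \in baby_verma_gr gM s -> Q s z.
Proof.
move=> Q0 QB QX Qc Qj s z /baby_verma_grP.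
elim=> [_ [t [a [x [at_ xs ->]]]]||z1 z2 _ Qz1 _ Qz2]; [|exact: Q0|exact: QB].
rewrite bv_tens_in; move/zspanP: at_.
elim=> [_ [c [l [lP lt ->]]]||a1 a2 _ Qa1 _ Qa2]; last first.
- by rewrite scalerBl; apply: QB.
- by rewrite scale0r; apply: Q0.
rewrite -scalerA; apply: Qc; have -> : s = (s (+) t) (+) t by rewrite -addbA addbb addbF.
rewrite -{2}lt {lt}; elim: l lP => [_|[e y] l IH /= /andP [/andP [yW ye] lP]].
  by rewrite !big_nil addbF scale1r; apply: Qj.
rewrite !big_cons /= -scalerA addbCA addbC; apply: QX => //; exact: IH.
Qed.

Lemma baby_verma_gr_closed s : zmod_closed (baby_verma_gr gM s).
Proof. exact: zspan_zmod_closed. Qed.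

Lemma baby_verma_gr_in s v : v \in gM s -> j v \in baby_verma_gr gM s.
Proof.
move=> vs; apply/baby_verma_grP/zspan_in; exists false, 1, v; rewrite addbF; split=> //.
by rewrite -(rmorph1 cU); apply: uenv_gr_scalar.
Qed.

Lemma uenv_grM (W : {vspace gl_mx}) s t (a b : uenv W p chi) :
  a \in uenv_gr W p chi s -> b \in uenv_gr W p chi t -> a * b \in uenv_gr W p chi (s (+) t).
Proof.
move=> /zspanP aP /zspanP bP; apply/zspanP; move: a aP.
apply: (zspan_prop_ind (g := fun a => a * b)) => [a1 a2|||a [c [l [lP ls ->]]]].
- exact: mulrBl.
- exact: zspan_0.
- exact: zspan_B.
move: b bP; apply: (zspan_prop_ind (g := fun b => _ * b)) => [b1 b2|||b [d [l' [lP' lt ->]]]].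
- exact: mulrBr.
- exact: zspan_0.
- exact: zspan_B.
apply: zspan_in; exists (c * d), (l ++ l'); rewrite all_cat lP lP' !big_cat /= ls lt; split=> //.
rewrite rmorphM -!mulrA; congr (_ * _); rewrite !mulrA; congr (_ * _).
by rewrite -uenv_scalarC.
Qed.

Lemma baby_verma_gr_act s t (a : U) z : a \in uenv_gr gl p chi t ->
  z \in baby_verma_gr gM s -> a *: z \in baby_verma_gr gM (s (+) t).
Proof.
move=> at_ /baby_verma_grP zs; apply/baby_verma_grP.
elim: zs => [_ [r [b [x [br xs ->]]]]||z1 z2 _ Hz1 _ Hz2]; last first.
- by rewrite scalerBr; apply: zspan_B.
- by rewrite scaler0; apply: zspan_0.
apply: zspan_in; exists (t (+) r), (a * b), x; split; first exact: uenv_grM.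
  by rewrite -addbA (addbA t) addbb addFb.
exact: bv_tensE.
Qed.
End BabyVermaStructure.

Theorem proposition4p2 (F : closedFieldType) (p : nat) (charF : p \in [pchar F])
  (p_gt3 : (3 < p)%N) (m n : nat) (mn_neq11 : (m, n) <> (1%N, 1%N))
  (chi : {scalar subvs_of (@gl0 F m n)})
  (chi_nil : forall x : subvs_of (@gl0 F m n), vsval x \in nil0 -> chi x = 0)
  (M : lmodType (uenv gl0 p chi)) (gM : bool -> {pred M})
  (gradedM : graded_module (uenv_gr gl0 p chi) gM)
  (simpleM : simple_module gM)
  (lambda : {scalar subvs_of (@cartan F m n)}) (v : M)
  (v_max : maximal_vector lambda v)
  (es fs : seq ('I_(m + n) * 'I_(m + n)))
  (esP : ascending_listing (@in_gl1 m n) es)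
  (fsP : ascending_listing (@in_glm1 m n) fs)
  (f1 : F)
  (f1P : (\prod_(ij <- es) uenv_in gl p chi (mx_unit ij)
          * \prod_(ij <- fs) uenv_in gl p chi (mx_unit ij)) *: bv_in v
         = uenv_scalar gl p chi f1 *: bv_in v) :
  (f1 <> 0 -> simple_module (baby_verma_gr gM))
  /\ (simple_module (baby_verma_gr gM) -> f1 <> 0).
Proof.
(* Invertibility of 2 serves the factor $1/2$ in [osc_1] and makes the square of an odd root vector
   act by zero. *)
have two_neq0 : (2%:R : F) != 0.
  by rewrite -(dvdn_pcharf charF) gtnNdvd // (ltn_trans _ p_gt3).
have [es_uniq esE _] := esP; have [fs_uniq fsE _] := fsP; have [v0 _ _] := v_max.
have [gM_closed gM_dec gM_cap gM_act] := gradedM.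
have gM_scale s c w : w \in gM s -> uenv_scalar gl0 p chi c *: w \in gM s.
  by move=> ws; have := gM_act _ _ _ _ (uenv_gr_scalar p chi gl0 c) ws; rewrite addFb.
have gM_gl0 s x w : x \in gl0 -> w \in gM s -> uenv_in gl0 p chi x *: w \in gM s.
  by move=> x0 ws; have := gM_act false _ _ _ (@uenv_gr_in F m n p chi gl0 false x x0 x0) ws; rewrite addFb.
have A_ind (Q : uenv gl0 p chi -> Prop) := @uenv_ind F m n gl0 p chi Q.
have U_ind (Q : uenv gl p chi -> Prop) :
    (forall f g, Q f -> Q g -> Q (f + g)) -> (forall f g, Q f -> Q g -> Q (f * g)) ->
    (forall c, Q (uenv_scalar gl p chi c)) -> (forall x, Q (uenv_in gl p chi x)) ->
    forall f, Q f.
  by move=> QD QM QC QX; apply: uenv_ind.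
(* The model is the Fock space with coefficients in $u(\mathfrak g_{\bar 0},\chi)$ and one mode for
   each element of [fs]. *)
have [pr [prB pr_j pr_glm1 pr_gl0 pr_scale]] :=
  bv_vacuum_coef charF two_neq0 fs_uniq fsE (fock_space (uenv gl0 p chi) fs) M.
have top_inj := bv_top_inj charF two_neq0 fs_uniq fsE (fock_space (uenv gl0 p chi) fs).
have cUC := uenv_scalarC (W := gl) (p := p) (chi := chi).
have iUlin := uenv_in_linear gl p chi.
have iUbr := uenv_in_scom p chi.
have act_in s t x z : x \in gl_parity t -> z \in baby_verma_gr gM s ->
    uenv_in gl p chi x *: z \in baby_verma_gr gM (s (+) t).
  by move=> xt; apply: baby_verma_gr_act; apply: uenv_gr_in => //; apply: mem_gl.
have act_sc s c z : z \in baby_verma_gr gM s ->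
    uenv_scalar gl p chi c *: z \in baby_verma_gr gM s.
  by rewrite -{2}[s]addbF; apply: baby_verma_gr_act; apply: uenv_gr_scalar.
have f1P' : uprod (uenv_in gl p chi) es (uprod (uenv_in gl p chi) fs (bv_in v))
    = uenv_scalar gl p chi f1 *: bv_in v by rewrite !uprodE scalerA.
split=> [|simpleZ f10].
  apply: (graded_verma_simple (Z := baby_verma M) two_neq0 cUC iUlin iUbr A_ind gM_closed
    gM_dec gM_scale gM_gl0 simpleM (@bv_in_zmod F m n p chi M) (@bv_in_scale F m n p chi M) _ _ _ _ prB pr_j
    es_uniq esE fs_uniq fsE v0 f1P').
  - by move=> x w x0; apply: bv_in_gl0.
  - by move=> x w x1; apply: bv_in_gl1.
  - exact: bv_gen_ind.
  - exact: (@baby_verma_gr_ind F m n p chi M gM).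
apply: (graded_verma_not_simple (Z := baby_verma M) two_neq0 cUC iUlin iUbr U_ind gM_closed
    gM_dec gM_cap gM_scale gM_gl0 (@bv_in_zmod F m n p chi M) (@bv_in_scale F m n p chi M) _ _ _ _
    (baby_verma_gr_closed gM) act_in act_sc _ prB pr_j pr_glm1 pr_gl0 pr_scale
    es_uniq esE fs_uniq fsE _ v0 _ simpleZ).
- by move=> x w x0; apply: bv_in_gl0.
- by move=> x w x1; apply: bv_in_gl1.
- exact: bv_gen_ind.
- exact: (@baby_verma_gr_ind F m n p chi M gM).
- exact: (@baby_verma_gr_in F m n p chi M gM).
- by move=> w; rewrite uprodE; apply: top_inj.
- by rewrite f1P' f10 rmorph0 scale0r.
Qed.
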